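(* Assume $\mathsf{FPT}$ does not contain the W-hierarchy. Let $f:\mathbb{N}\to\mathbb{N}$ be a computable function. Then there does not exist an algorithm that, given a stopwatch automaton $\mathbb{A}$ and a word $w$, decides whether $\mathbb{A}$ accepts $w$ in time $\big(\|\mathbb{A}\|\cdot f(c_\mathbb{A})\cdot t_\mathbb{A}\cdot|w|\big)^{O(1)}$.
   Context: A (specific) stopwatch automaton is a tuple $\mathbb{A}=(Q,\Sigma,X,\lambda,\beta,\zeta,\Delta)$ where $Q$ is a finite set of states containing two distinguished states $\mathit{start}$ and $\mathit{accept}$; $\Sigma$ is a finite nonempty alphabet; $X$ is a finite set of stopwatches; $\lambda:Q\to\Sigma$; $\beta:X\to\mathbb{N}$ assigns each stopwatch its bound; $\zeta\subseteq X\times Q$ ($x$ is active in $q$ iff $(x,q)\in\zeta$); $\Delta$ is a finite set of transitions $(q,g,\alpha,q')$ with $g$ a guard and $\alpha$ an action. An assignment is $\xi:X\to\mathbb{N}$ with $\xi(x)\le\beta(x)$. Guards are Boolean circuits taking the binary encoding of an assignment (a block of $\lceil\log(\beta(x)+1)\rceil$ bits per stopwatch) and outputting one bit; actions are Boolean circuits mapping such encodings to encodings of numbers $v_x$, the resulting assignment being $x\mapsto\min\{v_x,\beta(x)\}$. Edges $(q,\xi)\stackrel{t}{\to}(q',\xi')$ between nodes (state, assignment): either $t=0$ and some $(q,g,\alpha,q')\in\Delta$ has $\xi$ satisfying $g$ and $\alpha(\xi)=\xi'$; or $t>0$, $q=q'$, and $\xi'(x)=\min\{\xi(x)+t,\beta(x)\}$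 for $x$ active in $q$, $\xi'(x)=\xi(x)$ otherwise. A computation is a sequence $(q_0,\xi_0)\stackrel{t_0}{\to}\cdots\stackrel{t_{\ell-1}}{\to}(q_\ell,\xi_\ell)$ with $q_i\ne\mathit{accept}$ for $i<\ell$; it is initial if $q_0=\mathit{start}$ and $\xi_0\equiv0$, accepting if $q_\ell=\mathit{accept}$, and reads $\lambda(q_0)^{t_0}\cdots\lambda(q_{\ell-1})^{t_{\ell-1}}$. $\mathbb{A}$ accepts $w$ if some initial accepting computation reads $w$. $\|\mathbb{A}\|$ is the length of a reasonable binary encoding of $\mathbb{A}$, $c_\mathbb{A}=|X|$ is the number of stopwatches and $t_\mathbb{A}=\max_{x\in X}\beta(x)$ the largest stopwatch bound. $\mathsf{FPT}$ is the class of fixed-parameter tractable parameterized problems (decidable in time $g(k)\cdot n^{O(1)}$ for computable $g$, $n$ the input size, $k$ the parameter), and the W-hierarchy $\mathsf{W}[1]\subseteq\mathsf{W}[2]\subseteq\cdots$ is the standard hierarchy of parameterized complexity classes; the assumption means some problem in some class $\mathsf{W}[i]$ is not in $\mathsf{FPT}$. *)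

(* Defs.v *)
From mathcomp Require Import all_boot.

Set Implicit Arguments.
Unset Strict Implicit.
Unset Printing Implicit Defensive.

(** * Algorithms and their running time *)

(* Algorithms are structured programs over finitely many registers, each
   register being a stack of bits.  Every primitive operation and every test
   costs one time unit and touches only the top of one stack, so this is a
   multi-tape Turing machine with structured control: the two models simulate
   each other with constant-factor overhead. *)
Inductive prog : Type :=
  | Skip
  | Push of nat & bool
  | Pop of nat
  | Seq of prog & prog
  | Case of nat & prog & prog & prog
  | While of nat & prog.

Definition store : Type := nat -> seq bool.

Definition upd (s : store) (r : nat) (x : seq bool) : store :=
  fun r' => if r' == r then x else s r'.

(* [exec p s t s'] : started in store s, p halts after t time units in s'.
   Pop leaves an empty register empty; Case branches on register r being empty,
   having false on top, having true on top; While loops as long as r is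
   nonempty. *)
Inductive exec : prog -> store -> nat -> store -> Prop :=
  | exec_skip s : exec Skip s 1 s
  | exec_push r b s : exec (Push r b) s 1 (upd s r (b :: s r))
  | exec_pop r s : exec (Pop r) s 1 (upd s r (behead (s r)))
  | exec_seq p q s t s' t' s'' :
      exec p s t s' -> exec q s' t' s'' -> exec (Seq p q) s (t + t') s''
  | exec_case r pe pf pt s t s' :
      exec (if s r is b :: _ then if b then pt else pf else pe) s t s' ->
      exec (Case r pe pf pt) s t.+1 s'
  | exec_while_stop r p s : s r = [::] -> exec (While r p) s 1 s
  | exec_while_loop r p s t s' t' s'' :
      s r <> [::] -> exec p s t s' -> exec (While r p) s' t' s'' ->
      exec (While r p) s (t + t').+1 s''.

(* Input and output are both in register 0; the other registers start empty. *)
Definition init (x : seq bool) : store := upd (fun _ => [::]) 0 x.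

Definition runs (p : prog) (x : seq bool) (T : nat) (y : seq bool) : Prop :=
  exists t s, [/\ exec p (init x) t s, t <= T & s 0 = y].

Definition computable (f : nat -> nat) : Prop :=
  exists p : prog, forall n, exists T, runs p (nseq n true) T (nseq (f n) true).

(** * Binary encodings *)

(* bitlen n = ceil(log2(n + 1)) *)
Definition bitlen (n : nat) : nat := up_log 2 n.+1.

(* Least significant bit first. *)
Definition to_bits (len n : nat) : seq bool :=
  [seq odd (n %/ 2 ^ i) | i <- iota 0 len].

Definition of_bits (s : seq bool) : nat :=
  foldr (fun (b : bool) n => b + n.*2) 0 s.

Definition enc_seq (T : Type) (e : T -> seq bool) (s : seq T) : seq bool :=
  flatten [seq true :: e a | a <- s] ++ [:: false].

Definition enc_nat (n : nat) : seq bool :=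
  enc_seq (fun b => [:: b]) (to_bits (bitlen n) n).

(* Used for cardinalities of finite sets, so that a code is never shorter than
   the sets it describes. *)
Definition enc_unary (n : nat) : seq bool := rcons (nseq n true) false.

(** * Boolean circuits *)

(* The nodes of a circuit are numbered: first the n inputs, then the gates in
   topological order.  The arguments of a gate are numbers of earlier nodes;
   conjunctions and disjunctions have arbitrary fan-in. *)
Inductive gate : Type :=
  | Not of nat
  | And of seq nat
  | Or of seq nat.

Definition gate_args (g : gate) : seq nat :=
  match g with Not i => [:: i] | And s => s | Or s => s end.

Fixpoint wf_gates (n : nat) (gs : seq gate) : bool :=
  if gs is g :: gs' then
    all (fun i => i < n) (gate_args g) && wf_gates n.+1 gs'
  else true.

Record circuit (n m : nat) : Type := Circuit {
  gates : seq gate;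
  outs : m.-tuple nat;
  gates_wf : wf_gates n gates;
  outs_wf : all (fun i => i < n + size gates) outs
}.

Definition eval_gate (v : seq bool) (g : gate) : bool :=
  match g with
  | Not i => ~~ nth false v i
  | And s => all (nth false v) s
  | Or s => has (nth false v) s
  end.

Definition node_values (x : seq bool) (gs : seq gate) : seq bool :=
  foldl (fun v g => rcons v (eval_gate v g)) x gs.

Definition eval n m (C : circuit n m) (x : seq bool) : seq bool :=
  [seq nth false (node_values x (gates C)) i | i <- outs C].

(* Maximal total gate weight of a path from a source to each node. *)
Definition node_heights (w : gate -> nat) (n : nat) (gs : seq gate) : seq nat :=
  foldl (fun v g => rcons v (w g + \max_(i <- gate_args g) nth 0 v i))
        (nseq n 0) gs.

Definition height (w : gate -> nat) n m (C : circuit n m) : nat :=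
  \max_(i <- outs C) nth 0 (node_heights w n (gates C)) i.

Definition depth n m (C : circuit n m) : nat := height (fun _ => 1) C.

(* Large gates are those of fan-in greater than 2. *)
Definition weft n m (C : circuit n m) : nat :=
  height (fun g => 2 < size (gate_args g)) C.

Definition enc_gate (g : gate) : seq bool :=
  match g with
  | Not i => [:: false; false] ++ enc_nat i
  | And s => [:: false; true] ++ enc_seq enc_nat s
  | Or s => [:: true; true] ++ enc_seq enc_nat s
  end.

Definition enc_circuit n m (C : circuit n m) : seq bool :=
  enc_unary n ++ enc_seq enc_gate (gates C) ++ enc_seq enc_nat (outs C).

(** * Parameterized complexity *)

(* A parameterized decision problem, presented by its instances. *)
Record pproblem : Type := PProblem {
  instance : Type;
  code : instance -> seq bool;
  param : instance -> nat;
  yes : instance -> Prop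
}.

(* An algorithm is given the code of the instance and the parameter. *)
Definition input (P : pproblem) (I : instance P) : seq bool :=
  enc_unary (param I) ++ code I.

(* Arbitrary parameterized problems L, as subsets of {0,1}^* x nat. *)
Definition language (L : seq bool -> nat -> Prop) : pproblem :=
  PProblem (fun I : seq bool * nat => I.1) (fun I => I.2) (fun I => L I.1 I.2).

Definition FPT (P : pproblem) : Prop :=
  exists (p : prog) (g : nat -> nat) (c : nat),
    computable g /\
    forall I : instance P, exists b : bool,
      runs p (input I) (g (param I) * size (input I) ^ c) [:: b] /\
      (b <-> yes I).

Definition fpt_reducible (P P' : pproblem) : Prop :=
  exists (p : prog) (g h : nat -> nat) (c : nat),
    [/\ computable g, computable h &
     forall I : instance P, exists J : instance P',
       [/\ runs p (input I) (g (param I) * size (input I) ^ c) (input J),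
           param J <= h (param I) &
           yes I <-> yes J]].

(* Weighted satisfiability for circuits of weft at most i and depth at most d:
   is there a satisfying assignment with exactly k ones?  The parameter is k. *)
Record wsat_instance (i d : nat) : Type := WsatInstance {
  wsat_inputs : nat;
  wsat_circuit : circuit wsat_inputs 1;
  wsat_weight : nat;
  wsat_weft : weft wsat_circuit <= i;
  wsat_depth : depth wsat_circuit <= d
}.

Definition p_WSAT (i d : nat) : pproblem :=
  PProblem (fun I : wsat_instance i d => enc_circuit (wsat_circuit I))
           (fun I => wsat_weight I)
           (fun I => exists2 a : (wsat_inputs I).-tuple bool,
              count id a = wsat_weight I & eval (wsat_circuit I) a = [:: true]).

(* The class W[i], for i >= 1. *)
Definition W (i : nat) (L : seq bool -> nat -> Prop) : Prop :=
  exists d : nat, fpt_reducible (language L) (p_WSAT i d).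

Definition FPT_does_not_contain_W_hierarchy : Prop :=
  exists (i : nat) (L : seq bool -> nat -> Prop),
    [/\ 0 < i, W i L & ~ FPT (language L)].

(** * Stopwatch automata *)

(* Length of the binary encoding of an assignment, for stopwatch bounds beta. *)
Definition assignment_bits (c : nat) (beta : 'I_c -> nat) : nat :=
  \sum_(x < c) bitlen (beta x).

Record transition (q nb : nat) : Type := Transition {
  source : 'I_q;
  guard : circuit nb 1;
  action : circuit nb nb;
  target : 'I_q
}.

(* The finite sets Q, Sigma, X are initial segments of the natural numbers;
   Sigma is nonempty because it contains the label of start. *)
Record automaton : Type := Automaton {
  nstates : nat;
  nletters : nat;
  nwatches : nat;
  start : 'I_nstates;
  accept : 'I_nstates;
  start_neq_accept : start != accept;
  label : 'I_nstates -> 'I_nletters;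
  bound : 'I_nwatches -> nat;
  active : 'I_nwatches -> 'I_nstates -> bool;
  transitions : seq (transition nstates (assignment_bits bound))
}.

Section Semantics.
Variable A : automaton.

Definition valuation : Type := {ffun 'I_(nwatches A) -> nat}.

Definition is_assignment (xi : valuation) : bool :=
  [forall x, xi x <= bound x].

Definition block_sizes : seq nat :=
  [seq bitlen (bound x) | x <- enum 'I_(nwatches A)].

Definition enc_assignment (xi : valuation) : seq bool :=
  flatten [seq to_bits (bitlen (bound x)) (xi x) | x <- enum 'I_(nwatches A)].

Definition satisfies_guard nb (g : circuit nb 1) (xi : valuation) : bool :=
  eval g (enc_assignment xi) == [:: true].

Definition apply_action nb m (a : circuit nb m) (xi : valuation) : valuation :=
  let blocks := reshape block_sizes (eval a (enc_assignment xi)) in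
  [ffun x : 'I_(nwatches A) =>
     minn (of_bits (nth [::] blocks x)) (bound x)].

Definition node : Type := ('I_(nstates A) * valuation)%type.

Definition jump (u v : node) : bool :=
  has (fun d => [&& source d == u.1, satisfies_guard (guard d) u.2,
                    apply_action (action d) u.2 == v.2 & target d == v.1])
      (transitions A).

Definition wait (t : nat) (u v : node) : bool :=
  (u.1 == v.1) &&
  [forall x, v.2 x == if active x u.1 then minn (u.2 x + t) (bound x)
                      else u.2 x].

Definition edge (u : node) (t : nat) (v : node) : bool :=
  [&& is_assignment u.2, is_assignment v.2 &
      if t == 0 then jump u v else wait t u v].

(* A computation from u, given by its successive (time, node) pairs. *)
Fixpoint computation (u : node) (s : seq (nat * node)) : bool :=
  if s is (t, v) :: s' then
    [&& u.1 != accept A, edge u t v & computation v s']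
  else true.

Fixpoint word_read (u : node) (s : seq (nat * node)) : seq 'I_(nletters A) :=
  if s is (t, v) :: s' then nseq t (label u.1) ++ word_read v s' else [::].

Definition initial : node := (start A, [ffun=> 0]).

Definition accepts (w : seq 'I_(nletters A)) : Prop :=
  exists s : seq (nat * node),
    [/\ computation initial s,
        (last initial (unzip2 s)).1 = accept A &
        word_read initial s = w].

Definition max_bound : nat := \max_(x < nwatches A) bound x.

End Semantics.

Definition enc_transition q nb (d : transition q nb) : seq bool :=
  enc_nat (source d) ++ enc_circuit (guard d) ++ enc_circuit (action d) ++
  enc_nat (target d).

Definition enc_automaton (A : automaton) : seq bool :=
  enc_unary (nstates A) ++ enc_unary (nletters A) ++ enc_unary (nwatches A) ++
  enc_nat (start A) ++ enc_nat (accept A) ++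
  flatten [seq enc_nat (label q) | q <- enum 'I_(nstates A)] ++
  flatten [seq enc_nat (bound x) | x <- enum 'I_(nwatches A)] ++
  [seq active x q | x <- enum 'I_(nwatches A), q <- enum 'I_(nstates A)] ++
  enc_seq (@enc_transition _ _) (transitions A).

Definition enc_automaton_word (A : automaton) (w : seq 'I_(nletters A)) :
    seq bool :=
  enc_automaton A ++ enc_seq (fun a => enc_nat (nat_of_ord a)) w.

(* The bound (||A|| f(c_A) t_A |w|)^O(1).  Factors that may vanish are replaced
   by 1 when they do: otherwise the bound would be 0 already on the empty word,
   and no algorithm whatsoever could respect it. *)
Definition time_bound (f : nat -> nat) (e : nat) (A : automaton)
    (w : seq 'I_(nletters A)) : nat :=
  e * (size (enc_automaton A) * maxn 1 (f (nwatches A)) *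
       maxn 1 (max_bound A) * maxn 1 (size w)) ^ e.

Definition decides_acceptance_in_time (p : prog)
    (T : forall A : automaton, seq 'I_(nletters A) -> nat) : Prop :=
  forall (A : automaton) (w : seq 'I_(nletters A)), exists b : bool,
    runs p (enc_automaton_word w) (T A w) [:: b] /\ (b <-> accepts w).

(* Main.v *)
(* A circuit [C] with [n] inputs has a satisfying assignment of weight [k] iff
   the following automaton with [k + 2] stopwatches accepts [a^n].  One stopwatch
   is a clock with bound [n]; [k] further ones, never active, are records.  A
   transition without waiting shifts the records and stores the clock in the
   newest one, provided that time has passed since the last recording (a
   stopwatch with bound 1 tells).  The records thus run through distinct times
   between 1 and [n], and the transition to [accept] checks with a circuit that
   no record is 0 and that [C] is satisfied by the set of the recorded times.
   All bounds are at most [n + 1] and the number of stopwatches depends on [k]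
   only, so an algorithm within the time bound would decide weighted circuit
   satisfiability, for circuits of arbitrary weft, in fixed-parameter time, and
   with it every problem in the W-hierarchy. *)

From mathcomp Require Import all_boot zify.
From Stdlib Require Import FunctionalExtensionality.
Require Import Defs.

Set Implicit Arguments.
Unset Strict Implicit.
Unset Printing Implicit Defensive.

(** * Programs *)

(** The number of stopwatches must depend on [k] alone, so the [n] bits of an assignment cannot be
    kept; a set of weight [k] is kept as the list of its elements. Actions are functions, hence the
    set is guessed through the choice of the moments to jump. The length of the word fixes the total
    waiting time, so the clock always equals the number of letters read, and 0 stays free as the
    mark of a record not yet written: input [i] of [C] belongs to time [i.+1]. Algorithms are
    concrete stack programs, so the reduction has to be one as well, with a time bound. This shapes
    the final circuit: the nodes in front of [C] end with the [n] nodes that replace its inputs, so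
    the gates of [C] only need a constant added to their node numbers and can be copied while they
    are read. Finally, [f] need not be monotone and the reduction to weighted satisfiability only
    bounds the new parameter from above. The fixed-parameter bound therefore needs a computable
    majorant, which is built from sums by programs that call other programs. *)

(* A running time for [p], valid as long as no loop is iterated more than [N]
   times in a row: it makes the polynomial bound of a program syntactic. *)
Fixpoint tm (p : prog) (N : nat) : nat :=
  match p with
  | Seq p q => tm p N + tm q N
  | Case _ p q r => (tm p N + tm q N + tm r N).+1
  | While _ p => (N * (tm p N).+1).+1
  | _ => 1
  end.

Definition run (N : nat) (p : prog) (s s' : store) : Prop :=
  exists2 t, exec p s t s' & t <= tm p N.

(** One constant serves as factor and as exponent: [c * N ^ c] grows with [c] for positive [N], so
    bounds combine by adding constants. *)
Lemma tm_poly p : exists c, forall N, 0 < N -> tm p N <= c * N ^ c.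
Proof.
have le c d N : 0 < N -> c <= d -> c * N ^ c <= d * N ^ d.
  by move=> N0 cd; rewrite leq_mul // leq_pexp2l.
have add c d N : 0 < N -> c * N ^ c + d * N ^ d <= (c + d) * N ^ (c + d).
  by move=> N0; rewrite mulnDl leq_add // leq_mul2l leq_pexp2l ?orbT //; lia.
have one N : 0 < N -> 1 <= 1 * N ^ 1 by rewrite expn1; lia.
elim: p => [|r b|r|p [c IHp] q [d IHq]|r p [c IHp] q [d IHq] u [e IHu]|r p [c IHp]];
  try by exists 1 => N N0; exact: one.
- by exists (c + d) => N N0; apply: leq_trans (add _ _ _ N0); rewrite leq_add /= ?IHp ?IHq.
- exists (c + d + e + 1) => N N0; apply: leq_trans (add _ _ _ N0).
  rewrite /= -addn1 leq_add ?one //; apply: leq_trans (add _ _ _ N0).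
  by rewrite leq_add ?IHu //; apply: leq_trans (add _ _ _ N0); rewrite leq_add ?IHp ?IHq.
exists (c + 2) => N N0 /=; have := IHp _ N0; have : 0 < N ^ c by rewrite expn_gt0 N0.
rewrite expnD; set x := N ^ c; set y := tm p N => x0 yx.
have : N * y.+1 <= N * (c * x).+1 by rewrite leq_mul.
rewrite expnS expn1; have : N <= N * N by nia.
nia.
Qed.

Section Run.
Variable N : nat.

Lemma run_skip s : run N Skip s s.
Proof. by exists 1 => //; constructor. Qed.

Lemma run_push r b s : run N (Push r b) s (upd s r (b :: s r)).
Proof. by exists 1 => //; constructor. Qed.

Lemma run_pop r s : run N (Pop r) s (upd s r (behead (s r))).
Proof. by exists 1 => //; constructor. Qed.

Lemma run_seq p q s s' s'' : run N p s s' -> run N q s' s'' -> run N (Seq p q) s s''.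
Proof.
move=> [t e le] [t' e' le']; exists (t + t'); first exact: exec_seq e e'.
by rewrite leq_add.
Qed.

Lemma run_case r pe pf pt s s' :
  run N (if s r is b :: _ then if b then pt else pf else pe) s s' ->
  run N (Case r pe pf pt) s s'.
Proof.
move=> [t e le]; exists t.+1; first exact: exec_case.
by move: le => /=; case: (s r) => [|[] _]; lia.
Qed.

Lemma run_while r p n (S : nat -> store) : n <= N ->
  (forall i, i < n -> S i r <> [::] /\ run N p (S i) (S i.+1)) ->
  S n r = [::] -> run N (While r p) (S 0) (S n).
Proof.
move=> nN step stop.
have [t e le] : exists2 t, exec (While r p) (S 0) t (S n) & t <= (n * (tm p N).+1).+1.
  elim: n S {nN} step stop => [|n IH] S step stop; first by exists 1 => //; constructor.
  have [ne [t e le]] := step 0 isT.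
  have [t' e' le'] := IH (fun i => S i.+1) (fun i => step i.+1) stop.
  by exists (t + t').+1; [exact: exec_while_loop e e' | rewrite mulSn; lia].
by exists t => //; apply: leq_trans le _; rewrite ltnS leq_mul2r nN orbT.
Qed.

End Run.

(** Output length is thus bounded by running time; the size of the automaton never has to be
    computed. *)
Lemma exec_size p s t s' r : exec p s t s' -> size (s' r) <= size (s r) + t.
Proof.
elim=> {p s t s'}.
- by move=> s; lia.
- by move=> q b s; rewrite /upd; case: eqP => [->|_] /=; lia.
- by move=> q s; rewrite /upd; case: eqP => [->|_]; rewrite ?size_behead; lia.
- by move=> p q s t s' t' s'' _ ? _ ?; lia.
- by move=> q pe pf pt s t s' _ ?; lia.
- by move=> q p s _; lia.
- by move=> q p s t s' t' s'' _ _ ? _ ?; lia.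
Qed.

(** ** Composition *)

Fixpoint maxreg (p : prog) : nat :=
  match p with
  | Skip => 0
  | Push r _ | Pop r => r
  | Seq p q => maxn (maxreg p) (maxreg q)
  | Case r p q u => maxn r (maxn (maxreg p) (maxn (maxreg q) (maxreg u)))
  | While r p => maxn r (maxreg p)
  end.

Lemma exec_frame p s t s' r : exec p s t s' -> maxreg p < r -> s' r = s r.
Proof.
elim=> {p s t s'} //=.
- by move=> q b s; rewrite /upd; case: eqP => // ->; lia.
- by move=> q s; rewrite /upd; case: eqP => // ->; lia.
- by move=> p q s t s' t' s'' _ IH1 _ IH2 rm; rewrite IH2 ?IH1 //; lia.
- move=> q pe pf pt s t s' _ IH rm; apply: IH.
  by case: (s q) => [|[] _]; lia.
- by move=> q p s t s' t' s'' _ _ IH1 _ IH2 rm; rewrite IH2 ?IH1 //; lia.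
Qed.

Fixpoint rename (f : nat -> nat) (p : prog) : prog :=
  match p with
  | Skip => Skip
  | Push r b => Push (f r) b
  | Pop r => Pop (f r)
  | Seq p q => Seq (rename f p) (rename f q)
  | Case r p q u => Case (f r) (rename f p) (rename f q) (rename f u)
  | While r p => While (f r) (rename f p)
  end.

Lemma exec_rename f p s t s' S : injective f -> exec p s t s' ->
  (forall r, S (f r) = s r) ->
  exists S', [/\ exec (rename f p) S t S', forall r, S' (f r) = s' r &
                 forall q, (forall r, f r <> q) -> S' q = S q].
Proof.
move=> fI e; elim: e S => {p s t s'} /=.
- by move=> s S H; exists S; split=> //; constructor.
- move=> q b s S H; exists (upd S (f q) (b :: S (f q))); split; first by constructor.
    by move=> r; rewrite /upd (inj_eq fI) !H.
  by move=> r /(_ q) /nesym/eqP/negPf ne; rewrite /upd ne.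
- move=> q s S H; exists (upd S (f q) (behead (S (f q)))); split; first by constructor.
    by move=> r; rewrite /upd (inj_eq fI) !H.
  by move=> r /(_ q) /nesym/eqP/negPf ne; rewrite /upd ne.
- move=> p q s t s' t' s'' _ IH1 _ IH2 S /IH1[S' [e /IH2[S'' [e' H F]] F']].
  exists S''; split=> //; first exact: exec_seq e e'.
  by move=> r nr; rewrite F ?F'.
- move=> q pe pf pt s t s' _ IH S H; have [S' [e H' F]] := IH S H.
  exists S'; split=> //; apply: exec_case; rewrite H.
  by move: e; case: (s q) => [|[]].
- by move=> q p s sq S H; exists S; split=> //; constructor; rewrite H.
- move=> q p s t s' t' s'' sq _ IH1 _ IH2 S H.
  have [S' [e /IH2[S'' [e' H' F]] F']] := IH1 S H.
  exists S''; split=> //; last by move=> r nr; rewrite F ?F'.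
  by apply: exec_while_loop e e'; rewrite H.
Qed.

(* Register 0 is shared; the other registers of [q] are moved out of reach of
   [p], so that [q] finds them empty. *)
Definition comp (p q : prog) : prog :=
  Seq p (rename (fun r => if r is 0 then 0 else r + maxreg p) q).

Lemma runs_comp p q x T y T' z :
  runs p x T y -> runs q y T' z -> runs (comp p q) x (T + T') z.
Proof.
move=> [t [s [e le sy]]] [t' [s' [e' le' sz]]].
have I : injective (fun r => if r is 0 then 0 else r + maxreg p).
  by move=> [|a] [|b] //; lia.
have [|S' [e'' H _]] := exec_rename (S := s) I e'.
  move=> [|r]; first by rewrite sy.
  by rewrite (exec_frame e) //; lia.
exists (t + t'), S'; split; first exact: exec_seq e e''.
  by rewrite leq_add.
by rewrite (H 0).
Qed.

Lemma runs_le p x T T' y : runs p x T y -> T <= T' -> runs p x T' y.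
Proof. by move=> [t [s [e le sy]]] le'; exists t, s; split=> //; apply: leq_trans le'. Qed.

(** ** Computable functions *)

Definition st (l : seq (seq bool)) : store := nth [::] l.

Lemma upd_st l r x : upd (st l) r x = st (set_nth [::] l r x).
Proof.
by apply: functional_extensionality => r'; rewrite /upd /st nth_set_nth /=.
Qed.

Lemma st_eq l l' : (forall r, nth [::] l r = nth [::] l' r) -> st l = st l'.
Proof. by move=> H; apply: functional_extensionality => r; apply: H. Qed.

Lemma init_st x : init x = st [:: x].
Proof. by apply: functional_extensionality => -[|[|r]]. Qed.

Lemma run_mono N N' p s s' : N <= N' -> run N p s s' -> run N' p s s'.
Proof.
move=> le [t e let_]; exists t => //; apply: leq_trans let_ _.
elim: p {e} => //= [p IHp q IHq|r p IHp q IHq u IHu|r p IHp]; try lia.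
by rewrite ltnS leq_mul.
Qed.

(** A program may leave garbage behind, but [call] is iterated in loops and its program must find
    empty registers each time. *)
Definition clear (rs : seq nat) : prog :=
  foldr (fun r p => Seq (While r (Pop r)) p) Skip rs.

Lemma run_clear rs s :
  exists N, run N (clear rs) s (fun r => if r \in rs then [::] else s r).
Proof.
elim: rs s => [|a rs IH] s; first by exists 0; exact: run_skip.
have [N H] := IH (upd s a [::]).
exists (maxn (size (s a)) N) => /=; apply: (@run_seq _ _ _ _ (upd s a [::])).
  apply: (run_mono (leq_maxl _ _)).
  have := @run_while (size (s a)) a (Pop a) _ (fun i => upd s a (drop i (s a))) (leqnn _).
  have E : upd s a (s a) = s.
    by apply: functional_extensionality => r; rewrite /upd; case: eqP => // ->.
  rewrite drop0 drop_size E; apply; last by rewrite /upd eqxx.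
  move=> i lt; rewrite {1}/upd eqxx (drop_nth true lt); split=> //.
  set s1 := upd s a (_ :: _).
  have -> : upd s a (drop i.+1 (s a)) = upd s1 a (behead (s1 a)).
    by apply: functional_extensionality => r; rewrite /s1 /upd eqxx; case: eqP.
  exact: run_pop.
apply: (run_mono (leq_maxr _ _)).
set s1 := (X in run _ _ _ X) in H; set s2 := (X in run _ _ _ X); suff -> : s2 = s1 by [].
apply: functional_extensionality => r; rewrite /s1 /s2 /upd in_cons.
by case: eqP => [->|ne] //; case: ifP.
Qed.

Definition mv (a b : nat) : prog := While a (Seq (Pop a) (Push b true)).

Lemma run_mv N a b n s : a != b -> s a = nseq n true -> n <= N ->
  run N (mv a b) s (upd (upd s a [::]) b (nseq n true ++ s b)).
Proof.
move=> ab sa nN.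
have := @run_while N a (Seq (Pop a) (Push b true)) n
  (fun i => upd (upd s a (nseq (n - i) true)) b (nseq i true ++ s b)) nN.
rewrite subn0 subnn cat0s /=.
have {1}-> : upd (upd s a (nseq n true)) b (s b) = s.
  apply: functional_extensionality => r; rewrite /upd.
  by case: eqP => [->|_] //; case: eqP => [->|].
apply; last by rewrite /upd eqxx (negPf ab).
move=> i lt; have -> : n - i = (n - i.+1).+1 by lia.
set s1 := upd _ b _; have s1a : s1 a = nseq (n - i.+1).+1 true by rewrite /s1 /upd (negPf ab)
    eqxx.
split; first by rewrite s1a.
apply: run_seq (run_pop _ _ _) _; rewrite s1a /=.
set s2 := upd s1 a _; have -> : upd (upd s a (nseq (n - i.+1) true)) b
    (true :: nseq i true ++ s b) =
    upd s2 b (true :: s2 b).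
  apply: functional_extensionality => r; rewrite /s2 /s1 /upd eqxx [b == a]eq_sym (negPf ab).
  by case: (r == b) => //; case: (r == a).
exact: run_push.
Qed.

Definition spread (a b c : nat) : prog :=
  While a (Seq (Pop a) (Seq (Push b true) (Push c true))).

(* [p] runs in the even registers, so that 1, 3 and 5 are free for the argument,
   the accumulated result and scratch. *)
Definition call (p : prog) : prog :=
  Seq (Seq (spread 1 0 5) (mv 5 1))
 (Seq (rename (fun r => r.*2) p)
 (Seq (mv 0 3) (clear [seq r.*2 | r <- iota 0 (maxreg p).+1]))).

(** [computable] asks for termination only, so step counts are dropped here. *)
Definition halts p s s' := exists t, exec p s t s'.

Lemma run_halts N p s s' : run N p s s' -> halts p s s'.
Proof. by case=> t e _; exists t. Qed.

Lemma halts_seq p q s s' s'' : halts p s s' -> halts q s' s'' -> halts (Seq p q) s s''.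
Proof. by move=> [t e] [t' e']; exists (t + t'); apply: exec_seq e e'. Qed.

Lemma halts_while r p n (S : nat -> store) :
  (forall i, i < n -> S i r <> [::] /\ halts p (S i) (S i.+1)) ->
  S n r = [::] -> halts (While r p) (S 0) (S n).
Proof.
elim: n S => [|n IH] S step stop; first by exists 1; constructor.
have [ne [t e]] := step 0 isT.
have [t' e'] := IH (fun i => S i.+1) (fun i => step i.+1) stop.
by exists (t + t').+1; apply: exec_while_loop e e'.
Qed.

Notation pair_store n m := (st [:: [::]; nseq n true; [::]; nseq m true]).

Lemma halts_call (f : nat -> nat) p n m :
  (exists T, runs p (nseq n true) T (nseq (f n) true)) ->
  halts (call p) (pair_store n m) (pair_store n (f n + m)).
Proof.
move=> [T [t [s [e _ s0]]]].
pose S0 := st [:: nseq n true; nseq n true; [::]; nseq m true].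
have H0 : halts (Seq (spread 1 0 5) (mv 5 1)) (pair_store n m) S0.
  apply: (@halts_seq _ _ _
    (st [:: nseq n true; [::]; [::]; nseq m true; [::]; nseq n true])); last first.
    apply: (@run_halts n); set s1 := st _;
    have -> : S0 = upd (upd s1 5 [::]) 1 (nseq n true ++ s1 1).
      by rewrite /s1 !upd_st /= cats0; apply: st_eq => -[|[|[|[|[|[|r]]]]]] //=; rewrite !nth_nil.
    exact: run_mv.
  apply: (@run_halts n).
  have := @run_while n 1 (Seq (Pop 1) (Seq (Push 0 true) (Push 5 true))) n
    (fun i => st [:: nseq i true; nseq (n - i) true; [::]; nseq m true; [::]; nseq i true])
        (leqnn n).
  rewrite subn0 subnn /=.
  have -> : st [:: [::]; nseq n true; [::]; nseq m true; [::]; [::]] = pair_store n m.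
    by apply: st_eq => -[|[|[|[|[|[|r]]]]]] //=; rewrite !nth_nil.
  apply=> // i lt; rewrite /=; have -> : n - i = (n - i.+1).+1 by lia.
  split=> //; apply: run_seq (run_pop _ _ _) _.
  apply: run_seq (run_push _ _ _ _) _; rewrite !upd_st /=.
  set s1 := (X in run _ _ X _); set s2 := (X in run _ _ _ X).
  have -> : s2 = upd s1 5 (true :: s1 5) by rewrite upd_st.
  exact: run_push.
have [|S1 [e1 H1 F1]] := exec_rename (S := S0) double_inj e.
  by move=> [|[|[|r]]]; rewrite ?doubleS //= nth_nil.
pose S2 := upd (upd S1 0 [::]) 3 (nseq (f n) true ++ nseq m true).
have H2 : halts (mv 0 3) S1 S2.
  apply: (@run_halts (f n)).
  rewrite /S2; have -> : nseq m true = S1 3 by rewrite F1 // => -[|[|]].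
  by apply: run_mv => //; rewrite (H1 0).
have [N3 /run_halts H3] := run_clear [seq r.*2 | r <- iota 0 (maxreg p).+1] S2.
apply: (halts_seq H0); apply: halts_seq; first by exists t; exact: e1.
apply: (halts_seq H2).
set s1 := (X in halts _ _ X) in H3; set s2 := (X in halts _ _ X).
suff -> : s2 = s1 by [].
apply: functional_extensionality => r; rewrite /s1 /s2.
case: ifP => [/mapP[q _ ->]|nin]; first by case: q => [|[|q]] //; rewrite !doubleS /st /= nth_nil.
rewrite /S2 /upd.
case: eqP => [->|r3]; first by rewrite nseqD.
case: eqP => [->//|r0].
(* An odd register lies outside the renamed program; an even one beyond the cleared range was never
   touched by it. *)
have [q|nq] := boolP (r == r./2.*2); last first.
  rewrite F1; last by move=> q rq; move: nq; rewrite -rq doubleK eqxx.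
  by rewrite /S0 /st; move: r r3 r0 {nin nq} => [|[|[|[|r]]]] //=; rewrite !nth_nil.
have := H1 r./2; rewrite -(eqP q) => ->.
rewrite (exec_frame e).
  move: q r0; rewrite /st /init /upd; case: (r) => [|[|[|[|r1]]]] //= _ _.
  by rewrite nth_nil.
rewrite ltnNge; apply/negP => le; case/negP: (negbT nin); apply/mapP.
by exists r./2; [rewrite mem_iota | exact/eqP].
Qed.

Lemma computable_ext f g : f =1 g -> computable f -> computable g.
Proof. by move=> fg [p H]; exists p => n; rewrite -fg. Qed.

Lemma computable_id : computable id.
Proof. by exists Skip => n; exists 1, 1, (init (nseq n true)); split=> //; constructor. Qed.

Lemma computable_succ : computable succn.
Proof.
exists (Push 0 true) => n; exists 1, 1, (upd (init (nseq n true)) 0 (true :: nseq n true)).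
by split=> //; exact: exec_push.
Qed.

Lemma computable_comp f g : computable f -> computable g -> computable (g \o f).
Proof.
move=> [p Hp] [q Hq]; exists (comp p q) => n.
have [T H] := Hp n; have [T' H'] := Hq (f n); exists (T + T').
exact: runs_comp H H'.
Qed.

Lemma computable_acc f p :
  (forall n, exists m, halts p (pair_store n 0) (pair_store m (f n))) -> computable f.
Proof.
move=> H; exists (Seq (mv 0 1) (Seq p (mv 3 0))) => n.
have [m Hm] := H n.
pose s := upd (upd (pair_store m (f n)) 3 [::]) 0 (nseq (f n) true ++ [::]).
have [t e] : halts (Seq (mv 0 1) (Seq p (mv 3 0))) (init (nseq n true)) s.
  apply: (@halts_seq _ _ _ (pair_store n 0)).
    apply: (@run_halts n); have -> : pair_store n 0 =
        upd (upd (init (nseq n true)) 0 [::]) 1 (nseq n true ++ init (nseq n true) 1).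
      rewrite init_st !upd_st /= cats0; apply: st_eq => -[|[|[|[|r]]]] //=.
      by rewrite !nth_nil.
    exact: run_mv.
  apply: (halts_seq Hm); apply: (@run_halts (f n)).
  exact: (@run_mv _ 3 0 (f n) (pair_store m (f n))).
by exists t, t, s; split=> //; rewrite /s /upd /= cats0.
Qed.

Lemma computable_add f g : computable f -> computable g -> computable (fun n => f n + g n).
Proof.
move=> [p Hp] [q Hq]; apply: (@computable_acc _ (Seq (call p) (call q))) => n.
exists n; apply: halts_seq; first exact: (halts_call _ (Hp n)).
by rewrite addn0 addnC; apply: halts_call.
Qed.

(** The loop counter is also the argument of the call: it runs through [n], ..., 1, which explains
    the shift in [f i.+1]. *)
Lemma computable_sum f : computable f -> computable (fun n => \sum_(i < n) f i.+1).
Proof.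
move=> [p Hp]; apply: (@computable_acc _ (While 1 (Seq (call p) (Pop 1)))) => n.
exists 0.
have := @halts_while 1 (Seq (call p) (Pop 1)) n
  (fun i => pair_store (n - i) (\sum_(n - i <= j < n) f j.+1)).
rewrite subn0 subnn big_mkord big_geq //; apply=> // i lt.
have e : n - i = (n - i.+1).+1 by lia.
rewrite e; split=> //; apply: halts_seq; first by apply: halts_call; exact: Hp.
rewrite [X in halts _ _ (pair_store _ X)]big_ltn; last by lia.
set s := (X in halts _ X _); set s' := (X in halts _ _ X).
have -> : s' = upd s 1 (behead (s 1)) by rewrite upd_st.
exact: run_halts (@run_pop 0 _ _).
Qed.

(** Summing successors gives triangular numbers, and twice the one of [m] is [m * m.+1]. Upper
    bounds suffice, so no program for multiplication is written. *)
Lemma computable_sqr_bound f : computable f ->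
  exists2 g, computable g & forall n, f n ^ 2 <= g n.
Proof.
move=> cf; pose S n := \sum_(i < n) i.+1.
have cS : computable S by apply: (computable_sum computable_id).
exists (fun n => S (f n) + S (f n)).
  by apply: computable_add; apply: computable_comp cf cS.
move=> n; move: (f n) => m {f cf n cS}; rewrite /S.
elim: m => // m IH; rewrite big_ord_recr /=.
move: IH; set x := \sum_(i < m) _; rewrite !expnS !expn0 !muln1; nia.
Qed.

(** Repeated squaring reaches the exponent [2 ^ c], which exceeds [c]; the successor keeps the base
    positive, so the larger exponent gives the larger power. *)
Lemma computable_exp_bound f c : computable f ->
  exists2 g, computable g & forall n, f n ^ c <= g n.
Proof.
move=> cf; have [g cg H] : exists2 g, computable g & forall n, (f n).+1 ^ (2 ^ c) <= g n.
  elim: c => [|c [g cg H]].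
    by exists (succn \o f) => [|n]; [exact: computable_comp cf computable_succ | rewrite expn1].
  have [h ch H'] := computable_sqr_bound cg; exists h => // n.
  by apply: leq_trans (H' n); rewrite expnSr expnM leq_exp2r.
exists g => // n; apply: leq_trans (H n).
apply: (@leq_trans ((f n).+1 ^ c)); first by case: c {H} => // c; rewrite leq_exp2r.
by rewrite leq_pexp2l // ltnW // ltn_expl.
Qed.

(** * Circuits *)

Lemma wf_gates_cat n gs gs' :
  wf_gates n (gs ++ gs') = wf_gates n gs && wf_gates (n + size gs) gs'.
Proof. by elim: gs n => [|g gs IH] n /=; rewrite ?addn0 // IH -andbA addSnnS. Qed.

Lemma wf_gates_par n gs : all (fun g => all (fun i => i < n) (gate_args g)) gs -> wf_gates n gs.
Proof.
suff H d : all (fun g => all (fun i => i < n) (gate_args g)) gs -> wf_gates (n + d) gs.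
  by move=> /(H 0); rewrite addn0.
elim: gs d => //= g gs IH d /andP[a /IH]; rewrite -addnS => -> /=; rewrite andbT.
by apply: sub_all a => i /ltn_addr.
Qed.

Lemma node_values_cat x gs gs' : node_values x (gs ++ gs') = node_values (node_values x gs) gs'.
Proof. exact: foldl_cat. Qed.

Lemma size_node_values x gs : size (node_values x gs) = size x + size gs.
Proof. by elim: gs x => [|g gs IH] x /=; rewrite ?addn0 // IH size_rcons addSnnS. Qed.

Lemma eq_eval_gate (n : nat) v v' g :
  (forall i, i < n -> nth false v i = nth false v' i) ->
  all (fun i => i < n) (gate_args g) -> eval_gate v g = eval_gate v' g.
Proof.
move=> H; case: g => [i|s|s] /=; first by rewrite andbT => /H->.
  by move=> /allP a; apply: eq_in_all => i /a/H.
by move=> /allP a; apply: eq_in_has => i /a/H.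
Qed.

(** The values [u] appended by earlier gates of the layer lie behind [v], where no gate of the layer
    reads. *)
Lemma node_values_par v gs :
  all (fun g => all (fun i => i < size v) (gate_args g)) gs ->
  node_values v gs = v ++ map (eval_gate v) gs.
Proof.
suff H u : all (fun g => all (fun i => i < size v) (gate_args g)) gs ->
    node_values (v ++ u) gs = v ++ u ++ map (eval_gate v) gs.
  by move=> /H; rewrite -[v in node_values v]cats0 => ->.
elim: gs u => [|g gs IH] u /=; first by rewrite cats0.
move=> /andP[a /IH {}IH]; rewrite rcons_cat [LHS]IH cat_rcons; congr (_ ++ (_ ++ (_ :: _))).
by apply: eq_eval_gate a => i lt; rewrite nth_cat lt.
Qed.

(** Renumbering for a circuit that is placed behind [s] further nodes, its inputs becoming the nodes
    from [s] on. *)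
Definition shift_gate (s : nat) (g : gate) : gate :=
  match g with
  | Not i => Not (i + s)
  | And a => And [seq i + s | i <- a]
  | Or a => Or [seq i + s | i <- a]
  end.

Lemma wf_shift_gates s n gs : wf_gates n gs -> wf_gates (s + n) (map (shift_gate s) gs).
Proof.
elim: gs n => //= g gs IH n /andP[a /IH]; rewrite addnS => ->; rewrite andbT.
by case: g a => [i|u|u] /=; rewrite ?all_map; (try by rewrite !andbT addnC ltn_add2l);
   apply: sub_all => i /=; rewrite addnC ltn_add2l.
Qed.

Lemma node_values_shift u v gs :
  node_values (u ++ v) (map (shift_gate (size u)) gs) = u ++ node_values v gs.
Proof.
have n i : nth false (u ++ v) (i + size u) = nth false v i.
  by rewrite nth_cat ltnNge leq_addl /= addnK.
elim: gs v n => //= g gs IH v n; rewrite rcons_cat.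
have -> : eval_gate (u ++ v) (shift_gate (size u) g) = eval_gate v g.
  by case: g => [i|a|a] /=; rewrite ?n // ?all_map ?has_map; [apply: eq_all|apply: eq_has].
by apply: IH => i; rewrite nth_cat ltnNge leq_addl /= addnK.
Qed.

Lemma nth_flatten_const (T : Type) (x0 : T) b ss i l :
  all (fun s => size s == b) ss -> l < b ->
  nth x0 (flatten ss) (i * b + l) = nth x0 (nth [::] ss i) l.
Proof.
move=> a lb; elim: ss i a => [|s ss IH] i /=; first by rewrite !nth_nil.
move=> /andP[/eqP sb a]; rewrite nth_cat sb; case: i => [|i] /=; first by rewrite lb.
by rewrite mulSn -addnA ltnNge leq_addr /= addKn IH.
Qed.

Lemma size_to_bits b n : size (to_bits b n) = b.
Proof. by rewrite size_map size_iota. Qed.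

Lemma to_bitsS b n : to_bits b.+1 n = odd n :: to_bits b n./2.
Proof.
rewrite /to_bits /= expn0 divn1 (iotaDl 1) -map_comp; congr (_ :: _).
by apply: eq_map => i /=; rewrite expnS divnMA divn2.
Qed.

Lemma to_bitsK b n : n < 2 ^ b -> of_bits (to_bits b n) = n.
Proof.
elim: b n => [|b IH] n; first by case: n.
by rewrite to_bitsS /= => lt; rewrite IH ?odd_double_half // ltn_half_double -mul2n -expnS.
Qed.

Lemma ltn_exp_bitlen n : n < 2 ^ bitlen n.
Proof. exact: up_logP. Qed.

Lemma flatten_size_const (T : Type) b (ss : seq (seq T)) :
  all (fun s => size s == b) ss -> size (flatten ss) = size ss * b.
Proof. by elim: ss => //= s ss IH /andP[/eqP sb /IH {}IH]; rewrite size_cat sb IH mulSn. Qed.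

(** * The automaton *)

(* Stopwatch 0 is a clock, stopwatches 1 to [k] are records, and the last one
   tells whether time has passed since the latest recording. *)
Definition nbits (n k : nat) : nat := k.+1 * bitlen n + 1.

(** Recording is mere rewiring. The clock keeps its block; the blocks of the clock and of the newest
    [k - 1] records move up by one place, which drops the oldest record; node [nbits n k] is the
    empty disjunction, a constant false that clears the flag. *)
Definition record_outs (n k : nat) : seq nat :=
  iota 0 (bitlen n) ++ iota 0 (k * bitlen n) ++ [:: nbits n k].

(** Tests whether record [i] equals [j]. The negation of input [p] is node [p + nbits n k], so a
    zero bit of [j] shifts the reference by [nbits n k]. *)
Definition eq_gate (n k j i : nat) : gate :=
  And [seq i * bitlen n + l + (if odd (j %/ 2 ^ l) then 0 else nbits n k) | l <- iota 0 (bitlen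
      n)].

Definition not_gates (n k : nat) : seq gate := [seq Not p | p <- iota 0 (nbits n k)].
Definition eq_gates (n k : nat) : seq gate := [seq eq_gate n k j i | j <- iota 0 n.+1, i <- iota
    1 k].
Definition or_gates (n k : nat) : seq gate :=
  [seq Or [seq (nbits n k).*2 + (j * k + i) | i <- iota 0 k] | j <- iota 0 n.+1].

(** The first disjunction, the one for 0: it tells whether some record is still unwritten. The [n]
    disjunctions behind it say which of 1, ..., [n] are recorded; they take the place of the inputs
    of [C], whence the shift by [z.+1]. *)
Definition zero_node (n k : nat) : nat := (nbits n k).*2 + n.+1 * k.

Definition final_gates (n k : nat) (gs : seq gate) (o : nat) : seq gate :=
  let z := zero_node n k in
  not_gates n k ++ eq_gates n k ++ or_gates n k ++ map (shift_gate z.+1) gs ++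
  [:: Not z; And [:: z.+1 + n + size gs; o + z.+1]].

Definition final_out (n k : nat) (gs : seq gate) : nat := (zero_node n k).+1 + n + size gs + 1.

Definition blocks (n : nat) (v : seq nat) : seq bool := flatten [seq to_bits (bitlen n) r | r <-
    v].

Lemma size_blocks n v : size (blocks n v) = size v * bitlen n.
Proof.
rewrite (@flatten_size_const _ (bitlen n)) ?size_map //.
by rewrite all_map; apply/allP => r _; rewrite /= size_to_bits.
Qed.

Lemma nth_blocks n v i l : l < bitlen n -> i < size v ->
  nth false (blocks n v) (i * bitlen n + l) = nth false (to_bits (bitlen n) (nth 0 v i)) l.
Proof.
move=> lb iv; rewrite nth_flatten_const //; last first.
  by rewrite all_map; apply/allP => r _; rewrite /= size_to_bits.
by rewrite (nth_map 0).
Qed.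

(** * The circuit that checks the records *)

Section Eval.
Variables (n k : nat) (gs : seq gate) (o : nat).

Let m := nbits n k.
Let b := bitlen n.

Lemma node_lt i l : i <= k -> l < b -> i * b + l < m.
Proof. by rewrite /m /nbits -/b => ik lb; rewrite addn1 ltnS; nia. Qed.

Lemma args_not : all (fun g => all (fun i => i < m) (gate_args g)) (not_gates n k).
Proof. by rewrite all_map; apply/allP => p /=; rewrite mem_iota /= => ->. Qed.

Lemma all_flatten (U : Type) (a : pred U) ss : all a (flatten ss) = all (all a) ss.
Proof. by elim: ss => //= s ss IH; rewrite all_cat IH. Qed.

Lemma args_eq : all (fun g => all (fun i => i < m.*2) (gate_args g)) (eq_gates n k).
Proof.
rewrite all_flatten all_map; apply/allP => j _ /=; rewrite all_map; apply/allP => i.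
rewrite mem_iota add1n ltnS => /andP[_ ik] /=.
rewrite all_map; apply/allP => l /=; rewrite mem_iota /= => lb.
by have := node_lt ik lb; rewrite -addnn -/b -/m; case: ifP; lia.
Qed.

Lemma args_or : all (fun g => all (fun i => i < m.*2 + n.+1 * k) (gate_args g)) (or_gates n k).
Proof.
rewrite all_map; apply/allP => j; rewrite mem_iota /= => jn.
rewrite all_map; apply/allP => i; rewrite mem_iota /= => ik.
by rewrite ltn_add2l -/m; nia.
Qed.

Lemma size_eq_gates : size (eq_gates n k) = n.+1 * k.
Proof. by rewrite size_allpairs !size_iota. Qed.

Lemma final_wf : wf_gates n gs -> o < n + size gs -> wf_gates m (final_gates n k gs o).
Proof.
move=> wf lto; rewrite /final_gates /zero_node -/m.
move: (wf_gates_par args_not) (wf_gates_par args_eq) (wf_gates_par args_or).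
have : size (not_gates n k) = m by rewrite size_map size_iota.
have : size (or_gates n k) = n.+1 by rewrite size_map size_iota.
move: (not_gates n k) (eq_gates n k) (or_gates n k) size_eq_gates => A B C sB sC sA wA wB wC.
rewrite !wf_gates_cat wA sA addnn wB sB wC sC size_map /=.
have -> : m.*2 + n.+1 * k + n.+1 = (m.*2 + n.+1 * k).+1 + n by lia.
rewrite wf_shift_gates //= !andbT; lia.
Qed.

Variables (T : nat) (rs : seq nat) (y : bool).
Hypotheses (size_rs : size rs = k) (rs_n : all (fun r => r <= n) rs).

Let x := rcons (blocks n (T :: rs)) y.

Lemma size_x : size x = m.
Proof. by rewrite size_rcons size_blocks /= size_rs /m /nbits addn1. Qed.

Lemma eval_final : wf_gates n gs -> o < n + size gs ->
  nth false (node_values x (final_gates n k gs o)) (final_out n k gs) =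
  (0 \notin rs) && nth false (node_values [seq j \in rs | j <- iota 1 n] gs) o.
Proof.
move=> wf lto; rewrite /final_gates.
set z := zero_node n k.
have -> A B C E E' : node_values x (A ++ B ++ C ++ E ++ E') =
    node_values (node_values (node_values (node_values (node_values x A) B) C) E) E'.
  by rewrite !node_values_cat.
rewrite (@node_values_par x) ?size_x ?args_not //.
set x1 := x ++ _.
have x1E : x1 = x ++ map negb x.
  rewrite /x1 /not_gates -/m -size_x -map_comp; congr (_ ++ _).
  by rewrite -[RHS](mkseq_nth false) size_map; apply/eq_in_map => p; rewrite mem_iota /= => lt;
     rewrite (nth_map false).
have size_x1 : size x1 = m.*2 by rewrite x1E size_cat size_map size_x addnn.
rewrite (@node_values_par x1) ?size_x1 ?args_eq //.
set x2 := x1 ++ _.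
have x2E : x2 = x1 ++ flatten [seq [seq r == j | r <- rs] | j <- iota 0 n.+1].
  rewrite /x2 map_flatten -map_comp; congr (_ ++ flatten _).
  apply/eq_in_map => j; rewrite mem_iota /= ltnS => jn.
  rewrite -map_comp (iotaDl 1) -map_comp -size_rs.
  rewrite -[X in _ = map _ X](mkseq_nth 0) -map_comp; apply/eq_in_map => i.
  rewrite mem_iota add0n => /= ik.
  have ik' : i.+1 <= k by rewrite -size_rs.
  have -> : nth 0 rs i = nth 0 (T :: rs) i.+1 by [].
  set r := nth 0 (T :: rs) i.+1.
  have rn : r <= n by apply: (allP rs_n); exact: mem_nth.
  (* Both numbers are at most [n], hence determined by [bitlen n] bits. *)
  have -> : (r == j) = (to_bits b r == to_bits b j).
    apply/eqP/eqP => [->//|/(congr1 of_bits)].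
    by rewrite !to_bitsK // (leq_ltn_trans _ (ltn_exp_bitlen n)).
  rewrite /= all_map /= add1n -/b size_rs -/m.
  have -> : (to_bits b r == to_bits b j) =
      all (fun l => odd (r %/ 2 ^ l) == odd (j %/ 2 ^ l)) (iota 0 b).
    apply/eqP/allP => [/eq_in_map H l /H -> //|H].
    by apply/eq_in_map => l /H/eqP.
  apply: eq_in_all => l; rewrite mem_iota /= add0n => lb.
  have nx : nth false x (i.+1 * b + l) = odd (r %/ 2 ^ l).
    rewrite nth_rcons size_blocks nth_blocks //=.
    rewrite size_rs -/b (nth_map 0) ?size_iota // nth_iota // add0n.
    by have -> : i.+1 * b + l < k.+1 * b by nia.
  rewrite x1E nth_cat size_x; have lt := node_lt ik' lb; case: (odd (j %/ _)).
    by rewrite addn0 lt nx; case: odd.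
  by rewrite ltnNge leq_addl /= addnK (nth_map false) ?size_x // nx; case: odd.
have size_x2 : size x2 = m.*2 + n.+1 * k by rewrite size_cat size_map size_x1 size_eq_gates.
rewrite (@node_values_par x2) ?size_x2 ?args_or //.
set x3 := x2 ++ _.
(* Splitting off the disjunction for 0 leaves exactly the input vector of [C], placed right behind
   [z.+1] nodes. *)
have x3E : x3 = rcons x2 (0 \in rs) ++ [seq j \in rs | j <- iota 1 n].
  rewrite cat_rcons -[_ :: _]/[seq j \in rs | j <- iota 0 n.+1] /x3 -map_comp.
  congr (_ ++ _); apply/eq_in_map => j; rewrite mem_iota /= => jn.
  have -> : (j \in rs) = has (fun i => nth 0 rs i == j) (iota 0 k).
    by rewrite -has_pred1 -{1}[rs](mkseq_nth 0) size_rs has_map.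
  rewrite [LHS]has_map; apply: eq_in_has => i.
  rewrite mem_iota add0n => /= ik.
  rewrite x2E nth_cat size_x1 -/m ifN -?leqNgt ?leq_addr // addKn nth_flatten_const; last 2 first.
  - by rewrite all_map; apply/allP => j' _ /=; rewrite size_map size_rs.
  - by [].
  by rewrite (nth_map 0) ?size_iota // nth_iota // (nth_map 0) ?size_rs.
rewrite x3E -[z.+1](_ : size (rcons x2 (0 \in rs)) = z.+1); last first.
  by rewrite size_rcons size_x2.
rewrite node_values_shift.
set w := node_values _ gs; have size_w : size w = n + size gs.
  by rewrite size_node_values size_map size_iota.
set u := rcons _ _; have size_u : size u = z.+1 by rewrite size_rcons size_x2.
rewrite size_u /= andbT.
have uz : nth false (u ++ w) z = (0 \in rs).
  by rewrite nth_cat size_u leqnn /u nth_rcons size_x2 ltnn eqxx.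
have so : o + z.+1 < size (u ++ w) by rewrite size_cat size_u size_w; lia.
have e : z.+1 + n + size gs = size (u ++ w) by rewrite size_cat size_u size_w addnA.
rewrite uz /final_out -/z e addn1 -(size_rcons _ (~~ (0 \in rs))) nth_rcons ltnn eqxx.
rewrite !nth_rcons ltnn eqxx so nth_cat size_u ltnNge leq_addl /=.
by rewrite addnK.
Qed.
End Eval.

(** * The stopwatch automaton *)

Definition sw_bound (n k : nat) (x : 'I_k.+2) : nat := if x == k.+1 :> nat then 1 else n.

Lemma bitlen1 : bitlen 1 = 1. Proof. by []. Qed.

Lemma map_enum_ord_rcons (U : Type) k (f : nat -> U) :
  [seq f (nat_of_ord x) | x <- enum 'I_k.+2] = rcons [seq f i | i <- iota 0 k.+1] (f k.+1).
Proof.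
rewrite -[RHS]map_rcons; have -> : rcons (iota 0 k.+1) k.+1 = iota 0 k.+2.
  by rewrite -cats1 -[k.+2]addn1 iotaD.
by rewrite -val_enum_ord -map_comp.
Qed.

Lemma sum_enum_ord k (f : 'I_k.+2 -> nat) : \sum_(x < k.+2) f x = sumn [seq f x | x <- enum
    'I_k.+2].
Proof. by rewrite sumnE big_map big_enum. Qed.

Lemma sw_block_sizes n k :
  [seq bitlen (sw_bound n x) | x <- enum 'I_k.+2] = rcons (nseq k.+1 (bitlen n)) 1.
Proof.
rewrite (map_enum_ord_rcons _ (fun i => bitlen (if i == k.+1 then 1 else n))) eqxx.
congr (rcons _ _); apply: (@eq_from_nth _ 0); first by rewrite size_map size_iota size_nseq.
move=> i; rewrite size_map size_iota => lt.
by rewrite (nth_map 0) ?size_iota // nth_iota // nth_nseq lt add0n ltn_eqF.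
Qed.

Lemma sw_assignment_bits n k : assignment_bits (@sw_bound n k) = nbits n k.
Proof. by rewrite /assignment_bits sum_enum_ord sw_block_sizes sumn_rcons sumn_nseq mulnC. Qed.

Lemma size_record_outs n k : size (record_outs n k) = nbits n k.
Proof. by rewrite !size_cat !size_iota /= /nbits mulSn addnA. Qed.

Section Automaton.
Variables (n k : nat) (C : circuit n 1).

Notation nb := (assignment_bits (@sw_bound n k)).
Notation gs := (gates C).
Notation o := (thead (outs C)).

(** The circuits are typed by [assignment_bits]; its equality with [nbits] is used only inside the
    proofs of well-formedness, so no cast blocks the evaluation of the circuits. *)
Lemma ready_guard_wf : all (fun i => i < nb + 0) [tuple k.+1 * bitlen n].
Proof. by rewrite /= sw_assignment_bits addn0 /nbits addn1 ltnSn. Qed.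

Definition ready_guard : circuit nb 1 := @Circuit nb 1 [::] _ isT ready_guard_wf.

Lemma record_size : size (record_outs n k) == nb.
Proof. by rewrite size_record_outs sw_assignment_bits. Qed.

Lemma record_wf : all (fun i => i < nb + 1) (Tuple record_size).
Proof.
rewrite /= sw_assignment_bits !all_cat /= /nbits.
apply/and3P; split; last by rewrite andbT; lia.
  by apply/allP => i; rewrite mem_iota; nia.
by apply/allP => i; rewrite mem_iota; nia.
Qed.

Definition record_action : circuit nb nb := @Circuit nb nb [:: Or [::]] _ isT record_wf.

Lemma out_lt : o < n + size gs.
Proof. by move: (outs_wf C); case/tupleP: (outs C) => x t; rewrite theadE /= => /andP[]. Qed.

Lemma final_guard_wf : wf_gates nb (final_gates n k gs o).
Proof. rewrite sw_assignment_bits. refine (final_wf _ (gates_wf C) out_lt). Qed.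

Lemma size_final_gates : size (final_gates n k gs o) = (nbits n k + n.+1 * k + n.+1) + size gs +
    2.
Proof.
rewrite /final_gates size_cat size_map size_iota size_cat size_eq_gates.
by rewrite size_cat size_map size_iota size_cat size_map /= !addnA.
Qed.

Lemma final_out_wf :
  all (fun i => i < nb + size (final_gates n k gs o)) [tuple final_out n k gs].
Proof.
rewrite /= sw_assignment_bits size_final_gates /final_out /zero_node -addnn andbT.
by lia.
Qed.

Definition final_guard : circuit nb 1 := Circuit final_guard_wf final_out_wf.

(** All waiting happens in [start], under a single letter. Both transitions carry the same action,
    so one computation of its effect serves both. *)
Definition sw_automaton : automaton :=
  @Automaton 2 1 k.+2 ord0 ord_max isT (fun _ => ord0) (@sw_bound n k)
    (fun x _ => (x == 0 :> nat) || (x == k.+1 :> nat))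
    [:: Transition ord0 ready_guard record_action ord0;
        Transition ord0 final_guard record_action ord_max].

(** The newest record comes first, so that recording means consing [T] and truncating to length
    [k]. *)
Definition sw_val (T : nat) (rs : seq nat) (y : bool) : valuation sw_automaton :=
  [ffun x : 'I_k.+2 => nth 0 (T :: rcons rs (y : nat)) x].

Notation start_at T rs y := ((ord0, sw_val T rs y) : node sw_automaton).

Definition selects (rs : seq nat) : bool :=
  (0 \notin rs) && nth false (node_values [seq j \in rs | j <- iota 1 n] gs) o.

(** * Effect of a single edge *)

Section Step.
Variables (T : nat) (rs : seq nat) (y : bool).
Hypotheses (size_rs : size rs = k) (T_n : T <= n) (rs_n : all (fun r => r <= n) rs).

Lemma enc_sw_val : enc_assignment (sw_val T rs y) = rcons (blocks n (T :: rs)) y.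
Proof.
rewrite /enc_assignment.
have -> : [seq to_bits (bitlen (bound x)) (sw_val T rs y x) | x <- enum 'I_(nwatches
    sw_automaton)] =
    [seq to_bits (bitlen (if nat_of_ord x == k.+1 then 1 else n)) (nth 0 (T :: rcons rs y) x) | x
        <- enum 'I_k.+2].
  by apply: eq_map => x; rewrite ffunE.
rewrite (map_enum_ord_rcons _ (fun i => to_bits (bitlen (if i == k.+1 then 1 else n)) (nth 0 (T
    :: rcons rs y) i))).
rewrite flatten_rcons eqxx bitlen1 -rcons_cons nth_rcons /= -/(iota 0 k.+1).
rewrite size_rs ltnn eqxx to_bitsS /= cats1 /blocks.
have -> : odd y = y by case: (y).
congr (rcons (_ ++ flatten _) _).
rewrite -[RHS]/(map (to_bits (bitlen n)) rs) (iotaDl 1) -[in RHS](mkseq_nth 0 rs) size_rs /mkseq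
    -!map_comp.
apply/eq_in_map => i.
by rewrite mem_iota /= => lt; rewrite add1n nth_rcons size_rs lt eqSS ltn_eqF.
Qed.

Lemma eval_record :
  eval record_action (enc_assignment (sw_val T rs y)) =
  flatten (rcons [seq to_bits (bitlen n) r | r <- T :: take k (T :: rs)] [:: false]).
Proof.
rewrite enc_sw_val; set x := rcons _ _.
have size_x : size x = nbits n k by rewrite size_rcons size_blocks /= size_rs /nbits addn1.
rewrite /eval /= !map_cat /= -size_x nth_rcons ltnn eqxx flatten_rcons /=.
congr (_ ++ (_ ++ _)).
  rewrite -[RHS](mkseq_nth false) size_to_bits; apply/eq_in_map => l.
  rewrite mem_iota /= => lb; rewrite nth_rcons size_x /nbits ifT; last by nia.
  rewrite nth_rcons size_blocks /= ifT; last by nia.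
  by rewrite nth_cat size_to_bits lb.
rewrite -[flatten _]/(blocks n (take k (T :: rs))) -[RHS](mkseq_nth false).
rewrite size_blocks size_takel /= ?size_rs ?leqW //; apply/eq_in_map => l.
rewrite mem_iota /= => lb; rewrite nth_rcons size_x /nbits ifT; last by nia.
rewrite nth_rcons size_blocks /= ifT; last by nia.
rewrite -[in LHS](cat_take_drop k (T :: rs)) /blocks map_cat flatten_cat nth_cat.
by rewrite -/(blocks n _) size_blocks size_takel /= ?size_rs ?leqW // lb.
Qed.

Lemma size_take_rs : size (T :: take k (T :: rs)) = k.+1.
Proof. by rewrite /= size_takel //= size_rs leqW. Qed.

Lemma take_rs_le : all (fun r => r <= n) (take k (T :: rs)).
Proof. by apply/allP => r /mem_take; rewrite inE => /predU1P[->//|/(allP rs_n)]. Qed.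

Lemma sw_record :
  apply_action record_action (sw_val T rs y) = sw_val T (take k (T :: rs)) false.
Proof.
rewrite /apply_action eval_record.
have -> : block_sizes sw_automaton =
    shape (rcons [seq to_bits (bitlen n) r | r <- T :: take k (T :: rs)] [:: false]).
  rewrite /block_sizes sw_block_sizes /shape map_rcons -map_comp.
  rewrite (eq_map (g := fun=> bitlen n)) => [|r]; last by rewrite /= size_to_bits.
  congr (rcons _ _); rewrite -{1}size_take_rs.
  by elim: (T :: _) => //= ? l ->.
rewrite flattenK; apply/ffunP => x; rewrite !ffunE.
have -> : bound (a := sw_automaton) x = sw_bound n x by [].
rewrite -rcons_cons !nth_rcons size_map size_take_rs /sw_bound.
have [lt|] := ltnP x k.+1; last first.
  rewrite leq_eqVlt ltnNge -ltnS ltn_ord orbF => /eqP <-.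
  by rewrite eqxx.
rewrite ltn_eqF // (nth_map 0) ?size_take_rs //.
set r := nth 0 _ x.
have rn : r <= n.
  have : r \in T :: take k (T :: rs) by rewrite mem_nth // size_take_rs.
  by rewrite inE => /predU1P[->//|/(allP take_rs_le)].
by rewrite to_bitsK ?(minn_idPl rn) // (leq_ltn_trans rn (ltn_exp_bitlen n)).
Qed.

Lemma sw_jump v : jump (start_at T rs y) v =
  y && (v == start_at T (take k (T :: rs)) false) ||
  selects rs && (v == (ord_max, sw_val T (take k (T :: rs)) false)).
Proof.
case: v => q v; rewrite /jump /= orbF !xpair_eqE !sw_record; congr (_ || _).
  rewrite /satisfies_guard enc_sw_val /eval /= nth_rcons size_blocks /= size_rs ltnn eqxx.
  rewrite eqseq_cons andbT eqb_id.
  by rewrite [q == _]eq_sym [v == _]eq_sym [(ord0 == q) && _]andbC.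
have -> : satisfies_guard final_guard (sw_val T rs y) = selects rs.
  rewrite /satisfies_guard enc_sw_val /eval -[outs _]/[tuple final_out n k gs].
  rewrite -[gates _]/(final_gates n k gs o) [map _ _]/=.
  by rewrite (@eval_final n k gs o T rs y size_rs rs_n (gates_wf C) out_lt) eqseq_cons andbT
      eqb_id.
by rewrite [q == _]eq_sym [v == _]eq_sym [(ord_max == q) && _]andbC.
Qed.

(** The flag is active with bound 1, so any positive wait sets it. *)
Lemma sw_wait t v : 0 < t ->
  wait t (start_at T rs y) v = (v == start_at (minn (T + t) n) rs true).
Proof.
move=> t0; case: v => q v; rewrite /wait /= xpair_eqE [q == _]eq_sym; congr (_ && _).
have E x : (if active (a := sw_automaton) x ord0 then minn (sw_val T rs y x + t) (bound x)
    else sw_val T rs y x) = sw_val (minn (T + t) n) rs true x.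
  rewrite !ffunE /= /sw_bound; have [lt|] := ltnP x k.+1; last first.
    rewrite leq_eqVlt ltnNge -ltnS ltn_ord orbF => /eqP <-.
    by rewrite /= eqxx !nth_rcons size_rs ltnn eqxx; case: (y); lia.
  rewrite (ltn_eqF lt) orbF; case: x lt => -[|x] //= _ xk.
  by rewrite !nth_rcons size_rs -ltnS xk.
apply/forallP/eqP => [H|-> x]; last by rewrite E.
by apply/ffunP => x; rewrite (eqP (H x)) E.
Qed.

Lemma sw_is_assignment : is_assignment (sw_val T rs y).
Proof.
apply/forallP => x; rewrite ffunE /= /sw_bound -rcons_cons nth_rcons /= size_rs.
have [lt|] := ltnP x k.+1; last first.
  rewrite leq_eqVlt ltnNge -ltnS ltn_ord orbF => /eqP <-.
  by rewrite eqxx leq_b1.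
rewrite ltn_eqF //; case: x lt => -[|x] //= _ xk.
by apply: (allP rs_n); rewrite mem_nth // size_rs.
Qed.

End Step.

(** A set flag means that the clock has moved past every record, so the next time stored is new.
    Distinctness is claimed for nonzero records only, since all records start at 0. As clock plus
    remaining letters make [n], waiting never hits the bound of the clock. *)
Lemma run_sound s T rs (y : bool) :
  size rs = k -> all (fun r => r <= T) rs -> (y -> all (fun r => r < T) rs) ->
  uniq [seq r <- rs | r != 0] ->
  computation (start_at T rs y) s -> (last (start_at T rs y) (unzip2 s)).1 = ord_max ->
  T + size (word_read (start_at T rs y) s) = n ->
  exists rs', [/\ size rs' = k, all (fun r => r <= n) rs', uniq [seq r <- rs' | r != 0] & selects
      rs'].
Proof.
elim: s T rs y => [|[t v] s IH] T rs y //= size_rs rsT ylt un /andP[e c] la.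
rewrite size_cat size_nseq => sz.
have Tn : T <= n by lia.
have rsn : all (fun r => r <= n) rs by apply: sub_all rsT => r /leq_trans; apply.
case/and3P: e => _ _; case: eqP => [t0|/eqP].
  rewrite sw_jump // => /orP[/andP[yt /eqP vE]|/andP[sel _]]; last by exists rs.
  move: c la sz; rewrite vE t0 add0n => c la sz.
  have lt := ylt yt; apply: IH c la sz => //.
  - by have [] := size_take_rs T size_rs.
  - by apply/allP => r /mem_take; rewrite inE => /predU1P[->//|/(allP rsT)].
  (* The new records form a prefix of [T :: rs], and the strict bound granted by the flag keeps [T]
     out of [rs]. *)
  apply: (@subseq_uniq _ _ [seq r <- T :: rs | r != 0]).
    by rewrite -[X in subseq _ (filter _ X)](cat_take_drop k) filter_cat prefix_subseq.
  rewrite /=; case: ifP => //= _; rewrite un andbT mem_filter.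
  by apply/negP => /andP[_ /(allP lt)]; rewrite ltnn.
rewrite -lt0n => t0; rewrite sw_wait // => /eqP vE.
have e : minn (T + t) n = T + t by apply/minn_idPl; lia.
move: c la sz; rewrite vE e addnA => c la sz; apply: IH c la sz => //.
  by apply: sub_all rsT => r; lia.
by move=> _; apply: sub_all rsT => r; lia.
Qed.

(** [ps] holds the times still to be recorded. The flag is arbitrary: times increase strictly from
    [T] on, so a positive wait precedes each recording and sets it. *)
Lemma run_complete ps T rs (y : bool) :
  size rs = k -> T <= n -> all (fun r => r <= n) rs ->
  path ltn T ps -> all (fun r => r <= n) ps -> selects (take k (rev ps ++ rs)) ->
  exists s, [/\ computation (start_at T rs y) s,
    (last (start_at T rs y) (unzip2 s)).1 = ord_max &
    word_read (start_at T rs y) s = nseq (n - T) ord0].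
Proof.
elim: ps T rs y => [|p ps IH] T rs y size_rs Tn rsn /=.
  rewrite take_oversize ?size_rs // => _ _ sel.
  pose fin T := (ord_max, sw_val T (take k (T :: rs)) false) : node sw_automaton.
  have efin T' y' : T' <= n -> edge (start_at T' rs y') 0 (fin T').
    move=> T'n; rewrite /edge !sw_is_assignment ?take_rs_le //; last first.
      by have [] := size_take_rs T' size_rs.
    rewrite [if _ then _ else _]sw_jump // sel; apply/orP; right; exact: eqxx.
  (* An edge with time 0 is a jump, never an empty wait, so a clock that already shows [n] needs its
     own computation. *)
  have [lt|ge] := ltnP T n; last first.
    have -> : n = T by apply/eqP; rewrite eqn_leq ge Tn.
    by exists [:: (0, fin T)]; rewrite /= efin // subnn.
  exists [:: (n - T, start_at n rs true); (0, fin n)]; rewrite /= efin //= cats0 andbT; split=>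
      //.
  rewrite /edge !sw_is_assignment //= subn_eq0 leqNgt lt /= sw_wait ?subn_gt0 //.
  by rewrite subnKC // minnn.
move=> /andP[Tp pp] /andP[pn psn]; rewrite rev_cons cat_rcons => sel.
have size_rs' : size (take k (p :: rs)) = k by have [] := size_take_rs p size_rs.
have rsn' := take_rs_le pn rsn.
have [|s [c la wo]] := IH p (take k (p :: rs)) false size_rs' pn rsn' pp psn.
  (* Truncating to [k] records at each recording or once at the end gives the same list. *)
  move: sel; rewrite !take_cat; case: ltnP => // le.
  by rewrite -take_min; have -> : minn (k - size (rev ps)) k = k - size (rev ps) by lia.
exists ((p - T, start_at p rs true) :: (0, start_at p (take k (p :: rs)) false) :: s); split=>
    //=.
  rewrite c andbT /edge !sw_is_assignment //= subn_eq0 leqNgt Tp /=.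
  rewrite sw_wait ?subn_gt0 // subnKC ?(ltnW Tp) // (minn_idPl pn) eqxx /=.
  by rewrite sw_jump // eqxx.
by rewrite wo -nseqD; congr nseq; lia.
Qed.

Lemma eval_circuit1 x : eval C x = [:: nth false (node_values x gs) o].
Proof. by rewrite /eval; case/tupleP: (outs C) => z t; rewrite theadE /= (tuple0 t). Qed.

Theorem sw_automaton_correct :
  accepts (nseq n ord0 : seq 'I_(nletters sw_automaton)) <->
  exists2 a : n.-tuple bool, count id a = k & eval C a = [:: true].
Proof.
have init : initial sw_automaton = start_at 0 (nseq k 0) false.
  congr (_, _); apply/ffunP => x; rewrite !ffunE.
  have [lt|] := ltnP x k.+1; last first.
    rewrite leq_eqVlt ltnNge -ltnS ltn_ord orbF => /eqP <-.
    by rewrite /= nth_rcons size_nseq ltnn eqxx.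
  case: x lt => -[|x] //= _ xk; rewrite nth_rcons size_nseq -ltnS xk nth_nseq.
  by rewrite -ltnS xk.
rewrite /accepts init; split=> [[s [c la wo]]|[a ka Ca]].
  have [|||||rs [size_rs rsn un /andP[n0 sel]]] := run_sound _ _ _ _ c la.
  - by rewrite size_nseq.
  - by apply/allP => r /nseqP[->].
  - by [].
  - by elim: (k).
  - by rewrite wo size_nseq.
  have {}un : uniq rs.
    by move: un; rewrite (all_filterP _) //; apply/allP => r rin; apply: contraNneq n0 => <-.
  have sz : size [seq j \in rs | j <- iota 1 n] == n by rewrite size_map size_iota.
  exists (Tuple sz); last by rewrite eval_circuit1 /= sel.
  (* The weight is [k] because the records are distinct and lie in 1, ..., [n]: they are a
     permutation of the selected times. *)
  rewrite /= count_map -size_rs -size_filter; apply: perm_size.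
  apply: uniq_perm; rewrite ?filter_uniq ?iota_uniq // => r.
  rewrite mem_filter mem_iota /=; apply: andb_idr => rin.
  by rewrite add1n ltnS (allP rsn) // andbT lt0n; apply: contraNneq n0 => <-.
(* Times start at 1, positions in [a] at 0. *)
pose ps := [seq j <- iota 1 n | nth false a j.-1].
have size_ps : size ps = k.
  rewrite size_filter (iotaDl 1) count_map -ka -{2}[tval a](mkseq_nth false) size_tuple.
  by rewrite count_map; apply: eq_count => i /=; rewrite ?add1n.
have [||||||s [c la wo]] := @run_complete ps 0 (nseq k 0) false.
- by rewrite size_nseq.
- by [].
- by apply/allP => r /nseqP[->].
- rewrite path_min_sorted; last by apply/allP => r; rewrite mem_filter mem_iota; lia.
  by apply: sorted_filter; [exact: ltn_trans | exact: iota_ltn_sorted].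
- by apply/allP => r; rewrite mem_filter mem_iota; lia.
(* The [k] recordings have pushed out all initial zeros. *)
- rewrite take_size_cat ?size_rev // /selects mem_rev mem_filter mem_iota /= andbF.
  have -> : [seq j \in rev ps | j <- iota 1 n] = a.
    rewrite -[RHS](mkseq_nth false) size_tuple (iotaDl 1) -map_comp; apply/eq_in_map => i.
    rewrite mem_iota /= add0n => lt.
    by rewrite mem_rev mem_filter mem_iota add1n /= ltnS lt andbT.
  by move: Ca; rewrite eval_circuit1 => -[->].
by exists s; split; rewrite // wo subn0.
Qed.

End Automaton.

(** * The reduction as a program *)

(* Register 0 holds the rest of the input, register 1 the output written so
   far, in reverse, and register [r.+2] the entry [r] of [l] in unary.  [inc],
   [dec] and the macros below number the entries of [l], whereas [Case] and
   [Pop] number the registers. *)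
Definition conf (inp w : seq bool) (l : seq nat) : store := fun r =>
  match r with 0 => inp | 1 => rev w | r.+2 => nseq (nth 0 l r) true end.

Lemma conf_eq inp w l l' : (forall r, nth 0 l r = nth 0 l' r) -> conf inp w l = conf inp w l'.
Proof. by move=> H; apply: functional_extensionality => -[|[|r]] //=; rewrite H. Qed.

Definition inc r := Push r.+2 true.
Definition dec r := Pop r.+2.
Definition loop r p := While r.+2 p.
Definition emit b := Push 1 b.
Definition emits bs := foldr (fun b p => Seq (emit b) p) Skip bs.

(** * Unary counters, loops and binary output *)

Section Macros.
Variable N : nat.

Lemma upd_conf inp w l r x :
  upd (conf inp w l) r.+2 (nseq x true) = conf inp w (set_nth 0 l r x).
Proof.
apply: functional_extensionality => -[|[|q]] //=.
by rewrite /upd eqSS nth_set_nth /= eqSS; case: eqP.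
Qed.

Lemma run_inc inp w l r :
  run N (inc r) (conf inp w l) (conf inp w (set_nth 0 l r (nth 0 l r).+1)).
Proof. by rewrite -upd_conf; exact: run_push. Qed.

Lemma run_dec inp w l r :
  run N (dec r) (conf inp w l) (conf inp w (set_nth 0 l r (nth 0 l r).-1)).
Proof.
by rewrite -upd_conf; have := run_pop N r.+2 (conf inp w l); rewrite /=; case: (nth 0 l r).
Qed.

Lemma run_emit inp w l b : run N (emit b) (conf inp w l) (conf inp (w ++ [:: b]) l).
Proof.
have -> : conf inp (w ++ [:: b]) l = upd (conf inp w l) 1 (b :: conf inp w l 1).
  by apply: functional_extensionality => -[|[|r]] //=; rewrite /upd /= rev_cat.
exact: run_push.
Qed.

Lemma run_emits inp w l bs : run N (emits bs) (conf inp w l) (conf inp (w ++ bs) l).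
Proof.
elim: bs w => [|b bs IH] w /=; first by rewrite cats0; exact: run_skip.
by apply: run_seq (run_emit _ _ _ _) _; rewrite -[b :: bs]cat1s catA; exact: IH.
Qed.

Lemma run_read b inp w l : run N (Pop 0) (conf (b :: inp) w l) (conf inp w l).
Proof.
have -> : conf inp w l = upd (conf (b :: inp) w l) 0 (behead (conf (b :: inp) w l 0)).
  by apply: functional_extensionality => -[|[|r]].
exact: run_pop.
Qed.

Lemma run_loop r p n inp W V : n <= N ->
  (forall i, i < n -> 0 < nth 0 (V i) r /\
     run N p (conf inp (W i) (V i)) (conf inp (W i.+1) (V i.+1))) ->
  nth 0 (V n) r = 0 ->
  run N (loop r p) (conf inp (W 0) (V 0)) (conf inp (W n) (V n)).
Proof.
move=> nN H V0; apply: (@run_while N r.+2 p n (fun i => conf inp (W i) (V i)) nN) => [i /H[pos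
    ?]|].
  by split=> //=; case: (nth 0 (V i) r) pos.
by rewrite /= V0.
Qed.

Definition reset r := loop r (dec r).

Lemma run_reset inp w l r : nth 0 l r <= N ->
  run N (reset r) (conf inp w l) (conf inp w (set_nth 0 l r 0)).
Proof.
move=> le; set n := nth 0 l r.
have := @run_loop r (dec r) n inp (fun=> w) (fun i => set_nth 0 l r (n - i)) le.
rewrite subnn (@conf_eq _ _ _ l) => [|q]; last first.
  by rewrite nth_set_nth /= subn0; case: eqP => // ->.
apply=> [i lt|]; last by rewrite nth_set_nth /= eqxx.
rewrite nth_set_nth /= eqxx subn_gt0; split=> //.
have := run_dec inp w (set_nth 0 l r (n - i)) r.
rewrite set_set_nth eqxx nth_set_nth /= eqxx.
by have -> : (n - i).-1 = n - i.+1 by lia.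
Qed.

Definition move r c := loop r (Seq (dec r) (inc c)).

Lemma run_move inp w l r c : r != c -> nth 0 l r <= N ->
  run N (move r c) (conf inp w l)
    (conf inp w (set_nth 0 (set_nth 0 l r 0) c (nth 0 l c + nth 0 l r))).
Proof.
move=> rc le; set n := nth 0 l r.
pose V i := set_nth 0 (set_nth 0 l r (n - i)) c (nth 0 l c + i).
have VE i q : nth 0 (V i) q = if q == c then nth 0 l c + i else if q == r then n - i else nth 0 l
    q.
  by rewrite /V !nth_set_nth /= nth_set_nth.
rewrite (@conf_eq _ _ l (V 0)); last first.
  by move=> q; rewrite VE subn0 addn0; case: eqP => [->//|_]; case: eqP => [->|].
have <- : V n = set_nth 0 (set_nth 0 l r 0) c (nth 0 l c + n) by rewrite /V subnn.
apply: (@run_loop r (Seq (dec r) (inc c)) n inp (fun=> w) V le) => [i lt|]; last first.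
  by rewrite VE (negPf rc) eqxx subnn.
rewrite VE (negPf rc) eqxx subn_gt0; split=> //.
apply: run_seq (run_dec _ _ _ _) _; set l1 := set_nth _ _ r _.
rewrite (@conf_eq _ _ (V i.+1) (set_nth 0 l1 c (nth 0 l1 c).+1)); first exact: run_inc.
move=> q; rewrite VE /l1 !nth_set_nth /= !nth_set_nth /= !VE.
rewrite [c == r]eq_sym (negPf rc) !eqxx.
by case: (q == c); [lia | case: (q == r) => //; lia].
Qed.

Definition copy r c := Seq (loop r (Seq (dec r) (Seq (inc c) (inc 1)))) (move 1 r).

Lemma run_copy inp w l r c : r != c -> r != 1 -> c != 1 -> nth 0 l 1 = 0 -> nth 0 l r <= N ->
  run N (copy r c) (conf inp w l) (conf inp w (set_nth 0 l c (nth 0 l c + nth 0 l r))).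
Proof.
move=> rc r1 c1 l1 le; set n := nth 0 l r.
pose V i := set_nth 0 (set_nth 0 (set_nth 0 l r (n - i)) c (nth 0 l c + i)) 1 i.
have VE i q : nth 0 (V i) q = if q == 1 then i else if q == c then nth 0 l c + i else
   if q == r then n - i else nth 0 l q.
  by rewrite /V !nth_set_nth /= !nth_set_nth /= nth_set_nth.
rewrite (@conf_eq _ _ l (V 0)); last first.
  move=> q; rewrite VE subn0 addn0; case: eqP => [->//|_]; case: eqP => [->//|_].
  by case: eqP => [->|].
apply: (@run_seq _ _ _ _ (conf inp w (V n))).
  apply: (@run_loop r _ n inp (fun=> w) V le) => [i lt|]; last first.
    by rewrite VE (negPf r1) (negPf rc) eqxx subnn.
  rewrite VE (negPf r1) (negPf rc) eqxx subn_gt0; split=> //.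
  apply: run_seq (run_dec _ _ _ _) _; apply: run_seq (run_inc _ _ _ _) _.
  set l2 := set_nth _ _ c _.
  rewrite (@conf_eq _ _ (V i.+1) (set_nth 0 l2 1 (nth 0 l2 1).+1)); first exact: run_inc.
  move=> q; rewrite VE /l2 !nth_set_nth /= !nth_set_nth /= !nth_set_nth /= !VE.
  rewrite [1 == c]eq_sym [1 == r]eq_sym [c == r]eq_sym (negPf r1) (negPf c1) (negPf rc) !eqxx /=.
  by case: (q == 1) => //; case: (q == c); [lia | case: (q == r) => //; lia].
have := @run_move inp w (V n) 1 r; rewrite eq_sym r1 !VE !eqxx (negPf r1) (negPf rc) => /(_ isT
    le).
rewrite (@conf_eq _ _ (set_nth _ _ r _) (set_nth 0 l c (nth 0 l c + n))) // => q.
rewrite !nth_set_nth /= nth_set_nth /= VE.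
case: eqP => [->|qr]; first by rewrite (negPf rc) subnn.
by case: (eqVneq q 1) => [->|q1]; [rewrite eq_sym (negPf c1) | case: eqP].
Qed.

(** Counting down a copy keeps [r] available to the body and to nested loops. Entry 1 is the scratch
    space of [copy], hence the conditions on [r] and [c] below. *)
Definition for_ r c p := Seq (copy r c) (loop c (Seq (dec c) p)).

Lemma run_for r c p inp w (V : nat -> seq nat) f n :
  nth 0 (V 0) r = n -> n <= N -> r != c -> r != 1 -> c != 1 -> nth 0 (V 0) 1 = 0 ->
  (forall i, nth 0 (V i) c = 0) ->
  (forall i w, i < n -> run N p (conf inp w (set_nth 0 (V i) c (n - i.+1)))
                               (conf inp (w ++ f i) (set_nth 0 (V i.+1) c (n - i.+1)))) ->
  run N (for_ r c p) (conf inp w (V 0)) (conf inp (w ++ flatten [seq f i | i <- iota 0 n]) (V n)).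
Proof.
move=> vr nN rc r1 c1 v1 vc H.
apply: (run_seq (run_copy _ _ rc r1 c1 v1 _)); rewrite vr // vc.
pose U i := set_nth 0 (V i) c (n - i).
rewrite (@conf_eq _ _ (set_nth _ _ _ _) (U 0)) => [|q]; last by rewrite /U subn0.
rewrite (@conf_eq _ _ (V n) (U n)) => [|q]; last first.
  by rewrite /U subnn nth_set_nth /=; case: eqP => // ->.
pose W i := w ++ flatten [seq f i | i <- iota 0 i].
have W0 : W 0 = w by rewrite /W /= cats0.
have WS i : W i.+1 = W i ++ f i.
  by rewrite /W -addn1 iotaD map_cat flatten_cat /= cats0 catA.
rewrite -[in X in run _ _ X]W0 -/(W n).
apply: (@run_loop c (Seq (dec c) p) n inp W U nN) => [i lt|].
  rewrite nth_set_nth /= eqxx subn_gt0; split=> //.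
  apply: run_seq (run_dec _ _ _ _) _.
  rewrite /U set_set_nth eqxx nth_set_nth /= eqxx WS.
  have -> : (n - i).-1 = n - i.+1 by lia. by apply: H.
by rewrite nth_set_nth /= eqxx subnn.
Qed.
(* Reads a sequence written by [enc_seq]; [g] flags that more items may come. *)
Definition parse g p :=
  Seq (inc g) (loop g (Case 0 (dec g) (Seq (Pop 0) (dec g)) (Seq (Pop 0) p))).

Lemma run_parse (U : Type) (e : U -> seq bool) g p xs inp W V :
  size xs < N -> (forall ys, nth 0 (V ys) g = 0) ->
  (forall ys x zs inp, xs = ys ++ x :: zs ->
     run N p (conf (e x ++ inp) (W ys) (set_nth 0 (V ys) g 1))
             (conf inp (W (rcons ys x)) (set_nth 0 (V (rcons ys x)) g 1))) ->
  run N (parse g p) (conf (enc_seq e xs ++ inp) (W [::]) (V [::])) (conf inp (W xs) (V xs)).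
Proof.
move=> xsN vg H; apply: run_seq (run_inc _ _ _ _) _; rewrite vg.
(* The loop runs once more than there are items, to consume the terminator; hence the strict bound
   on [size xs]. *)
pose I i := if i <= size xs then enc_seq e (drop i xs) ++ inp else inp.
pose X i := conf (I i) (W (take i xs)) (set_nth 0 (V (take i xs)) g (i <= size xs)).
rewrite (@conf_eq _ _ (V xs) (set_nth 0 (V xs) g 0)) => [|q]; last first.
  by rewrite nth_set_nth /=; case: eqP => // ->.
have -> : conf (enc_seq e xs ++ inp) (W [::]) (set_nth 0 (V [::]) g 1) = X 0.
  by rewrite /X /I drop0 take0.
have Xn : conf inp (W xs) (set_nth 0 (V xs) g 0) = X (size xs).+1.
  by rewrite /X /I ltnn take_oversize.
rewrite Xn; apply: run_while => // [i|]; last by rewrite -Xn /= nth_set_nth /= eqxx.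
rewrite ltnS => le; rewrite /X le /= nth_set_nth /= eqxx; split=> //.
apply: run_case; rewrite /= /I le.
move: le; rewrite leq_eqVlt => /orP[/eqP->|lt]; rewrite ?ltnn ?lt.
  rewrite drop_size /= take_size take_oversize //.
  apply: run_seq (run_read _ _ _ _) _.
  have := run_dec inp (W xs) (set_nth 0 (V xs) g 1) g.
  by rewrite set_set_nth eqxx nth_set_nth /= eqxx.
have [x0 _] : exists x0 : U, True by case: (xs) lt => // x0 s _; exists x0.
rewrite (drop_nth x0 lt) /=.
apply: run_seq (run_read _ _ _ _) _.
have := H (take i xs) (nth x0 xs i) (drop i.+1 xs) (enc_seq e (drop i.+1 xs) ++ inp).
rewrite -(drop_nth x0 lt) cat_take_drop => /(_ erefl).
by rewrite (take_nth x0 lt) /enc_seq /= !catA.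
Qed.

(** Each pass removes two units and adds one to entry 2; a lone last unit becomes the remainder in
    entry 3. There are [uphalf] many passes, the last of which adds nothing to entry 2 if the number
    is odd. *)
Definition halve :=
  Seq (loop 0 (Seq (dec 0) (Case 2 (inc 3) Skip (Seq (dec 0) (inc 2))))) (move 2 0).

Lemma run_halve inp w l : nth 0 l 2 = 0 -> nth 0 l 3 = 0 -> nth 0 l 0 <= N ->
  run N halve (conf inp w l)
    (conf inp w (set_nth 0 (set_nth 0 l 0 (nth 0 l 0)./2) 3 (odd (nth 0 l 0)))).
Proof.
move=> l2 l3 le; set a := nth 0 l 0.
pose V i := set_nth 0 (set_nth 0 (set_nth 0 l 0 (a - i.*2)) 2 (minn i a./2)) 3 (odd a && (a <
    i.*2)).
have VE i q : nth 0 (V i) q = if q == 3 then odd a && (a < i.*2) : nat else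
    if q == 2 then minn i a./2 else if q == 0 then a - i.*2 else nth 0 l q.
  by rewrite /V !nth_set_nth /= !nth_set_nth /= nth_set_nth.
rewrite (@conf_eq _ _ l (V 0)); last first.
  move=> q; rewrite VE ltn0 andbF min0n subn0; case: eqP => [->//|_].
  by case: eqP => [->//|_]; case: eqP => [->|].
have ae := odd_double_half a; have ue : uphalf a = odd a + a./2 by rewrite uphalf_half.
apply: (@run_seq _ _ _ _ (conf inp w (V (uphalf a)))).
  apply: (@run_loop 0 _ (uphalf a) inp (fun=> w) V) => [|i lt|]; first by lia.
    rewrite VE /= subn_gt0; split; first by lia.
    apply: run_seq (run_dec _ _ _ _) _; set l1 := set_nth _ _ _ _.
    have l1E q : nth 0 l1 q = if q == 0 then (a - i.*2).-1 else nth 0 (V i) q.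
      by rewrite /l1 nth_set_nth /= VE.
    apply: run_case; rewrite /= l1E /=.
    case E : (a - i.*2).-1 => [|m] /=.
      rewrite (@conf_eq _ _ (V i.+1) (set_nth 0 l1 3 (nth 0 l1 3).+1)); first exact: run_inc.
      move=> q; rewrite nth_set_nth /= !l1E !VE /=; case: (eqVneq q 3) => [_|_]; first by lia.
      by case: (eqVneq q 2) => [->|_] /=; first lia; case: eqP => //; lia.
    apply: run_seq (run_dec _ _ _ _) _; set l2' := set_nth _ _ _ _.
    have l2E q : nth 0 l2' q = if q == 0 then m else nth 0 (V i) q.
      by rewrite /l2' nth_set_nth /= !l1E /= E; case: (q == 0).
    rewrite (@conf_eq _ _ (V i.+1) (set_nth 0 l2' 2 (nth 0 l2' 2).+1)); first exact: run_inc.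
    move=> q; rewrite nth_set_nth /= !l2E !VE /=; case: (eqVneq q 3) => [->|_] /=; first by lia.
    by case: (eqVneq q 2) => [_|_] /=; first lia; case: eqP => //; lia.
  by rewrite VE /=; lia.
set l' := set_nth 0 _ 3 _.
rewrite (@conf_eq _ _ l' (set_nth 0 (set_nth 0 (V (uphalf a)) 2 0) 0 (nth 0 (V (uphalf a)) 0 +
    nth 0 (V (uphalf a)) 2))).
  by apply: run_move; rewrite // VE /=; lia.
move=> q; rewrite /l' !nth_set_nth /= !nth_set_nth /= !VE /=.
case: (eqVneq q 3) => [->|_] /=; first by lia.
case: (eqVneq q 0) => [_|_] /=; first by rewrite nth_set_nth /=; lia.
by case: eqP => [->|].
Qed.

Definition emit_bit := Seq (emit true) (Case 5 (emit false) Skip (Seq (dec 3) (emit true))).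

Lemma run_emit_bit inp w l b : nth 0 l 3 = nat_of_bool b ->
  run N emit_bit (conf inp w l) (conf inp (w ++ [:: true; b]) (set_nth 0 l 3 0)).
Proof.
move=> l3; apply: run_seq (run_emit _ _ _ _) _.
apply: run_case; rewrite /= l3; case: b l3 => /= l3.
  apply: run_seq (run_dec _ _ _ _) _; rewrite l3.
  have := run_emit inp (w ++ [:: true]) (set_nth 0 l 3 0) true.
  by rewrite -catA.
rewrite -(@conf_eq _ _ l) => [|q]; last by rewrite nth_set_nth /=; case: eqP => // ->.
by have := run_emit inp (w ++ [:: true]) l false; rewrite -catA.
Qed.

Definition bits p := loop 0 (Seq halve p).

Lemma bitlen_le a : bitlen a <= a.
Proof. by apply: up_log_min => //; apply: ltn_expl. Qed.

(** By minimality of [up_log], the quotient by [2 ^ i] is positive for [i < bitlen a], so there are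
    exactly [bitlen a] passes. *)
Lemma run_bits p inp W V a : a <= N ->
  (forall i, [/\ nth 0 (V i) 0 = a %/ 2 ^ i, nth 0 (V i) 2 = 0 & nth 0 (V i) 3 = 0]) ->
  (forall i, i < bitlen a ->
     run N p (conf inp (W i) (set_nth 0 (set_nth 0 (V i) 0 (a %/ 2 ^ i.+1)) 3 (odd (a %/ 2 ^ i))))
             (conf inp (W i.+1) (V i.+1))) ->
  run N (bits p) (conf inp (W 0) (V 0)) (conf inp (W (bitlen a)) (V (bitlen a))).
Proof.
move=> aN HV H; apply: run_loop => [|i lt|]; first exact: leq_trans (bitlen_le a) aN.
  have [v0 v2 v3] := HV i; split.
    rewrite v0 divn_gt0 ?expn_gt0 // leqNgt; apply/negP => gt.
    by have := up_log_min (isT : 1 < 2) gt; rewrite leqNgt lt.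
  apply: (run_seq (run_halve _ _ v2 v3 _)); first by rewrite v0 (leq_trans (leq_div _ _)).
  have := H i lt; rewrite v0; congr (run _ _ (conf _ _ (set_nth _ (set_nth _ _ _ _) _ _)) _).
  by rewrite expnSr divnMA divn2.
by have [-> _ _] := HV (bitlen a); rewrite divn_small // ltn_exp_bitlen.
Qed.

Definition enc := Seq (bits emit_bit) (emit false).

Lemma run_enc inp w l : nth 0 l 2 = 0 -> nth 0 l 3 = 0 -> nth 0 l 0 <= N ->
  run N enc (conf inp w l) (conf inp (w ++ enc_nat (nth 0 l 0)) (set_nth 0 l 0 0)).
Proof.
move=> l2 l3 le; set a := nth 0 l 0.
pose V i := set_nth 0 l 0 (a %/ 2 ^ i).
pose W i := w ++ flatten [seq [:: true; odd (a %/ 2 ^ j)] | j <- iota 0 i].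
apply: (@run_seq _ _ _ _ (conf inp (W (bitlen a)) (V (bitlen a)))); last first.
  have := run_emit inp (W (bitlen a)) (V (bitlen a)) false.
  rewrite /W /V -catA divn_small ?ltn_exp_bitlen //.
  by rewrite /enc_nat /enc_seq /to_bits -map_comp.
rewrite (@conf_eq _ _ l (V 0)) => [|q]; last first.
  by rewrite nth_set_nth /= divn1; case: eqP => [->|].
have -> : w = W 0 by rewrite /W cats0.
apply: run_bits => // [i|i lt]; first by rewrite !nth_set_nth /= l2 l3.
have -> : set_nth 0 (V i) 0 (a %/ 2 ^ i.+1) = V i.+1 by rewrite /V set_set_nth eqxx.
have -> : W i.+1 = W i ++ [:: true; odd (a %/ 2 ^ i)].
  by rewrite /W -(addn1 i) iotaD map_cat flatten_cat /= catA.
have := @run_emit_bit inp (W i) (set_nth 0 (V i.+1) 3 (odd (a %/ 2 ^ i))) (odd (a %/ 2 ^ i)).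
rewrite nth_set_nth set_set_nth eqxx => /(_ erefl).
rewrite (@conf_eq _ _ (set_nth _ _ _ 0) (V i.+1)) // => q.
by rewrite nth_set_nth /= /V nth_set_nth /=; case: eqP => [->|].
Qed.

Definition put r := Seq (copy r 0) enc.

(* The registers used by the macros themselves are empty. *)
Definition idle l := [&& nth 0 l 0 == 0, nth 0 l 1 == 0, nth 0 l 2 == 0 & nth 0 l 3 == 0].

Lemma idleP l : idle l -> [/\ nth 0 l 0 = 0, nth 0 l 1 = 0, nth 0 l 2 = 0 & nth 0 l 3 = 0].
Proof. by case/and4P=> /eqP ? /eqP ? /eqP ? /eqP ?. Qed.

Lemma run_put inp w l r : idle l -> 1 < r -> nth 0 l r <= N ->
  run N (put r) (conf inp w l) (conf inp (w ++ enc_nat (nth 0 l r)) l).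
Proof.
move=> /idleP[l0 l1 l2 l3] r1 le.
have rn x : x < 2 -> r != x by move=> ?; lia.
apply: (run_seq (run_copy _ _ _ _ _ _ _)) => //; try exact: rn.
rewrite l0 add0n; set l' := set_nth _ _ _ _.
have := @run_enc inp w l'; rewrite /l' !nth_set_nth /= => /(_ l2 l3 le).
rewrite (@conf_eq _ _ (set_nth _ _ _ 0) l) // => q.
by rewrite !nth_set_nth /=; case: (eqVneq q 0) => [->|/negPf q0]; rewrite ?nth_set_nth /= ?q0.
Qed.

End Macros.

Lemma bitlen_half a : 0 < a -> bitlen a = (bitlen a./2).+1.
Proof. exact: up_log2S. Qed.

Lemma enc_nat_half a : 0 < a -> enc_nat a = [:: true, odd a & enc_nat a./2].
Proof. by move=> a0; rewrite /enc_nat bitlen_half // to_bitsS. Qed.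

(* Addition of a unary number to a binary one that is read bit by bit, least
   significant first: the unary number serves as the carry. *)
Definition carry (r : nat * seq bool) (b : bool) : nat * seq bool :=
  ((r.1 + b)./2, r.2 ++ [:: true; odd (r.1 + b)]).

(** Once the bits of [o] are used up, the carry is the high part of the sum, and its own code
    completes the output. Node numbers of [C] can thus be shifted without decoding them. *)
Lemma add_stream o s w :
  let r := foldl carry (s, w) (to_bits (bitlen o) o) in
  r.2 ++ enc_nat r.1 = w ++ enc_nat (o + s).
Proof.
elim/ltn_ind: o s w => o IH s w; case: (posnP o) => [->//|o0].
rewrite bitlen_half // to_bitsS [foldl _ _ _]/= /carry IH; last by rewrite ltn_half_double; lia.
rewrite -catA [enc_nat (o + s)]enc_nat_half ?addn_gt0 ?o0 //=.
have -> : odd (s + odd o) = odd (o + s) by rewrite !oddD oddb addbC.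
by have -> : o./2 + (s + odd o)./2 = (o + s)./2 by lia.
Qed.

Section AddNat.
Variable N : nat.

Definition read_bit := Case 0 Skip (Pop 0) (Seq (Pop 0) (inc 0)).
Definition add_nat :=
  Seq (copy 8 0) (Seq (parse 17 (Seq read_bit (Seq halve emit_bit))) enc).

Lemma run_add_nat inp w l o : idle l -> nth 0 l 17 = 0 -> nth 0 l 8 < N -> bitlen o < N ->
  run N add_nat (conf (enc_nat o ++ inp) w l) (conf inp (w ++ enc_nat (o + nth 0 l 8)) l).
Proof.
move=> /idleP[l0 l1 l2 l3] l17 sN oN; set s := nth 0 l 8.
apply: run_seq; first by apply: run_copy => //; apply: ltnW.
rewrite l0 add0n -/s.
pose R ys := foldl carry (s, w) ys.
have RS ys b : R (rcons ys b) = carry (R ys) b by rewrite /R foldl_rcons.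
(* The carry never grows: half of [s + 1], rounded down, is at most [s]. *)
have RN ys : (R ys).1 < N.
  elim/last_ind: ys => [|ys b IH]; first by [].
  by rewrite RS /=; case: b => /=; lia.
apply: run_seq.
  have := @run_parse N bool (fun b => [:: b]) 17 (Seq read_bit (Seq halve emit_bit)) (to_bits
      (bitlen o) o) inp
    (fun ys => (R ys).2) (fun ys => set_nth 0 l 0 (R ys).1).
  apply=> [|ys|ys b zs inp' _]; first by rewrite size_to_bits.
    by rewrite nth_set_nth.
  set l' := set_nth 0 _ 17 1.
  apply: (@run_seq _ _ _ _ (conf inp' (R ys).2 (set_nth 0 l' 0 ((R ys).1 + b)))).
    apply: run_case; case: b => /=.
      apply: run_seq (run_read _ _ _ _ _) _.
      have := run_inc N inp' (R ys).2 l' 0; rewrite {2}/l' !nth_set_nth /= nth_set_nth /=.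
      by rewrite addn1.
    have := run_read N false inp' (R ys).2 l'; rewrite (@conf_eq _ _ (set_nth _ _ 0 _) l') // =>
        q.
    by rewrite addn0 nth_set_nth /=; case: eqP => [->|//]; rewrite /l' !nth_set_nth /=
        nth_set_nth.
  apply: run_seq; first apply: run_halve.
  - by rewrite nth_set_nth /= /l' nth_set_nth /= nth_set_nth.
  - by rewrite nth_set_nth /= /l' nth_set_nth /= nth_set_nth.
  - by rewrite nth_set_nth /=; have := RN ys; case: b; lia.
  rewrite nth_set_nth /=; set l2' := set_nth _ _ 3 _.
  have := @run_emit_bit N inp' (R ys).2 l2' (odd ((R ys).1 + b)).
  rewrite {1}/l2' nth_set_nth /= => /(_ erefl).
  rewrite (@conf_eq _ _ (set_nth 0 l2' 3 0) (set_nth 0 (set_nth 0 l 0 (R (rcons ys b)).1) 17 1))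
      => [|q].
    by rewrite RS.
  rewrite RS /l2' /l' /= !nth_set_nth /= !nth_set_nth /= !nth_set_nth /= !nth_set_nth /=.
  rewrite !nth_set_nth /=.
  case: (eqVneq q 3) => [->|_] //; case: (eqVneq q 0) => [->|/negPf q0] //.
  by rewrite nth_set_nth /= q0.
set l' := set_nth _ _ _ _.
have := @run_enc N inp (R (to_bits (bitlen o) o)).2 l'; rewrite /l' !nth_set_nth /=.
rewrite (add_stream o s w) => /(_ l2 l3 (ltnW (RN _))).
rewrite (@conf_eq _ _ (set_nth _ _ _ 0) l) // => q.
by rewrite !nth_set_nth /=; case: (eqVneq q 0) => [->|/negPf q0]; rewrite ?nth_set_nth /= ?q0.
Qed.
End AddNat.

Lemma run_emits_to N inp w w' l bs :
  w' = w ++ bs -> run N (emits bs) (conf inp w l) (conf inp w' l).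
Proof. by move=> ->; apply: run_emits. Qed.

Lemma run_emit_to N inp w w' l b :
  w' = w ++ [:: b] -> run N (emit b) (conf inp w l) (conf inp w' l).
Proof. by move=> ->; apply: run_emit. Qed.

Lemma run_to N p s s' s'' : run N p s s' -> s' = s'' -> run N p s s''.
Proof. by move=> H <-. Qed.

Ltac step tac := apply: run_seq; [tac | cbv beta; rewrite ?[set_nth _ _ _ _]/=].

(** * Writing the circuits of the automaton *)

Section Main.
Variables (N n k G : nat).
Notation b := (bitlen n).
Notation m := (nbits n k).
Notation z := (zero_node n k).
Hypothesis big : z + n + G + 10 < N.

(* Entries 0 to 3 are scratch; then come [k], [n], [bitlen n] and [nbits n k];
   [p] is a node number, [e] counts nodes up to the final gates, [q] is shifted
   right from [j] to read off its bits, [c1] to [c3] count down the loops, and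
   the last three are the flags of [parse]. *)
Notation state n' p e j q c1 c2 c3 :=
  [:: 0; 0; 0; 0; k; n'; b; m; p; e; j; q; c1; c2; c3; 0; 0; 0].

Let bounds : [/\ k < N, n.+1 < N, b < N, m.*2 < N & z.+1 + n + G + 1 < N].
Proof.
have zE : z = m.*2 + n.+1 * k by [].
have mE : m = k.+1 * b + 1 by [].
split; nia.
Qed.

Definition emit_p := Seq (emit true) (Seq (put 8) (inc 8)).

Lemma run_emit_p inp w n' p e j q c1 c2 c3 : p <= N ->
  run N emit_p (conf inp w (state n' p e j q c1 c2 c3))
    (conf inp (w ++ true :: enc_nat p) (state n' p.+1 e j q c1 c2 c3)).
Proof.
move=> pN; step ltac:(apply: run_emit); step ltac:(by apply: run_put).
by rewrite -catA; apply: run_inc.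
Qed.

Definition unary_m := Seq (for_ 7 12 (emit true)) (emit false).

Lemma run_unary_m inp w p e j q c2 c3 :
  run N unary_m (conf inp w (state n p e j q 0 c2 c3))
    (conf inp (w ++ enc_unary m) (state n p e j q 0 c2 c3)).
Proof.
have [_ _ _ mN _] := bounds.
step ltac:(apply: (@run_for N 7 12 _ _ _ (fun=> state n p e j q 0 c2 c3) (fun=> [:: true]) m) =>
    //; first by lia).
  by move=> i w' _; apply: run_emit.
have -> : flatten [seq [:: true] | _ <- iota 0 m] = nseq m true.
  by rewrite -{2}(size_iota 0 m); elim: iota => //= ? l ->.
by rewrite /enc_unary -cats1 catA; apply: run_emit.
Qed.

Lemma enc_seq_flatten (U V : Type) (e : U -> seq bool) (f : V -> U) s :
  enc_seq e [seq f x | x <- s] = flatten [seq true :: e (f x) | x <- s] ++ [:: false].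
Proof. by rewrite /enc_seq -map_comp. Qed.

(** A range of length [k * b] is written by two nested loops; the node counter is not reset between
    them, so its values are consecutive. *)
Lemma flatten_iota_mul (U : Type) (f : nat -> seq U) a c :
  flatten [seq f i | i <- iota 0 (a * c)] =
  flatten [seq flatten [seq f (i * c + l) | l <- iota 0 c] | i <- iota 0 a].
Proof.
elim: a => // a IH; rewrite mulSnr iotaD -[a.+1]addn1 iotaD !map_cat !flatten_cat IH /= cats0.
rewrite add0n; have -> : iota (a * c) c = map (addn (a * c)) (iota 0 c) by rewrite -iotaDl addn0.
by rewrite -map_comp.
Qed.

Lemma enc_seq1 (U : Type) (e : U -> seq bool) x : enc_seq e [:: x] = true :: e x ++ [:: false].
Proof. by rewrite /enc_seq /= cats0. Qed.

Definition record_p :=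
  Seq unary_m
 (Seq (emits (enc_seq enc_gate [:: Or [::]]))
 (Seq (for_ 6 12 emit_p)
 (Seq (reset 8)
 (Seq (for_ 4 12 (for_ 6 13 emit_p))
 (Seq (reset 8)
 (Seq (emit true) (Seq (put 7) (emit false)))))))).

Lemma run_record inp w e j q :
  run N record_p (conf inp w (state n 0 e j q 0 0 0))
    (conf inp (w ++ enc_unary m ++ enc_seq enc_gate [:: Or [::]] ++
      enc_seq enc_nat (record_outs n k))
       (state n 0 e j q 0 0 0)).
Proof.
have [kN nN bN mN _] := bounds.
have kbm : k * b <= m by rewrite /nbits; lia.
step ltac:(apply: run_unary_m); step ltac:(apply: run_emits).
step ltac:(apply: (@run_for N 6 12 _ _ _ (fun i => state n i e j q 0 0 0) (fun i => true ::
    enc_nat i) b) => //; first by lia).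
  by move=> i w' lt; apply: run_emit_p; lia.
step ltac:(by apply: run_reset => /=; lia).
step ltac:(apply: (@run_for N 4 12 _ _ _ (fun i => state n (i * b) e j q 0 0 0)
  (fun i => flatten [seq true :: enc_nat (i * b + l) | l <- iota 0 b]) k) => //; first by lia).
  move=> i w' lt; rewrite mulSnr; set c := k - i.+1.
  have := @run_for N 6 13 emit_p inp w' (fun l => state n (i * b + l) e j q c 0 0)
    (fun l => true :: enc_nat (i * b + l)) b.
  rewrite addn0; apply=> //; first by lia.
  move=> l w2 ltl; rewrite addnS; apply: run_emit_p; nia.
step ltac:(by apply: run_reset => /=; lia).
step ltac:(apply: run_emit); step ltac:(by apply: run_put => //=; lia).
have -> : enc_seq enc_nat (record_outs n k) =
    flatten [seq true :: enc_nat i | i <- iota 0 b] ++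
    flatten [seq flatten [seq true :: enc_nat (i * b + l) | l <- iota 0 b] | i <- iota 0 k] ++
    [:: true] ++ enc_nat m ++ [:: false].
  rewrite /enc_seq /record_outs !map_cat !flatten_cat -!catA; congr (_ ++ (_ ++ _)).
    by rewrite (flatten_iota_mul (fun i => true :: enc_nat i)).
  by rewrite /= -?catA.
rewrite !catA; exact: run_emit.
Qed.

Definition header_p :=
  Seq (emits (enc_unary 2 ++ enc_unary 1 ++ [:: true; true]))
 (Seq (for_ 4 12 (emit true))
 (Seq (emits (false :: enc_nat 0 ++ enc_nat 1 ++ enc_nat 0 ++ enc_nat 0))
 (Seq (for_ 4 12 (put 5))
 (Seq (put 5)
 (Seq (emits (enc_nat 1 ++ [:: true; true]))
 (Seq (for_ 4 12 (emits [:: false; false]))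
      (emits [:: true; true]))))))).

Definition header_code : seq bool :=
  (enc_unary 2 ++ enc_unary 1 ++ [:: true; true]) ++
  flatten [seq [:: true] | _ <- iota 0 k] ++
  (false :: enc_nat 0 ++ enc_nat 1 ++ enc_nat 0 ++ enc_nat 0) ++
  flatten [seq enc_nat n | _ <- iota 0 k] ++
  enc_nat n ++ (enc_nat 1 ++ [:: true; true]) ++
  flatten [seq [:: false; false] | _ <- iota 0 k] ++ [:: true; true].

Lemma run_header inp w p e j q c2 c3 :
  run N header_p (conf inp w (state n p e j q 0 c2 c3))
    (conf inp (w ++ header_code) (state n p e j q 0 c2 c3)).
Proof.
have [kN nN bN mN _] := bounds; rewrite /header_code.
step ltac:(apply: run_emits).
step ltac:(apply: (@run_for N 4 12 _ _ _ (fun=> state n p e j q 0 c2 c3) (fun=> [:: true]) k) =>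
    //; first by lia).
  by move=> i w' _; apply: run_emit.
step ltac:(apply: run_emits).
step ltac:(apply: (@run_for N 4 12 _ _ _ (fun=> state n p e j q 0 c2 c3) (fun=> enc_nat n) k) =>
    //; first by lia).
  by move=> i w' _; apply: run_put => //=; lia.
step ltac:(by apply: run_put => //=; lia).
step ltac:(apply: run_emits).
step ltac:(apply: (@run_for N 4 12 _ _ _ (fun=> state n p e j q 0 c2 c3) (fun=> [:: false;
    false]) k) => //; first by lia).
  by move=> i w' _; apply: run_emits.
by apply: run_emits_to; rewrite -!catA.
Qed.

Definition ready_p :=
  Seq unary_m (Seq (emits [:: false; true]) (Seq (copy 7 0) (Seq (dec 0) (Seq enc (emit
      false))))).

Lemma run_ready inp w p e j q c2 c3 :
  run N ready_p (conf inp w (state n p e j q 0 c2 c3))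
    (conf inp (w ++ enc_unary m ++ enc_seq enc_gate [::] ++ enc_seq enc_nat [:: k.+1 * b])
      (state n p e j q 0 c2 c3)).
Proof.
have [kN nN bN mN _] := bounds.
step ltac:(apply: run_unary_m); step ltac:(apply: run_emits).
step ltac:(by apply: run_copy => //=; lia); step ltac:(apply: run_dec).
step ltac:(by apply: run_enc => //=; lia).
rewrite [nth _ _ _]/= add0n; have -> : m.-1 = k.+1 * b by rewrite /nbits addn1.
by apply: run_emit_to; rewrite enc_seq1; move: (enc_nat _) => u; rewrite -!catA.
Qed.

Definition not_p := Seq (for_ 7 12 (Seq (emits [:: true; false; false]) (Seq (put 8) (inc 8))))
    (reset 8).

Lemma run_not inp w e j q c2 c3 :
  run N not_p (conf inp w (state n 0 e j q 0 c2 c3))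
    (conf inp (w ++ flatten [seq true :: enc_gate g | g <- not_gates n k]) (state n 0 e j q 0 c2
        c3)).
Proof.
have [kN nN bN mN _] := bounds.
step ltac:(apply: (@run_for N 7 12 _ _ _ (fun i => state n i e j q 0 c2 c3) (fun p => [:: true,
    false, false & enc_nat p]) m) => //; first by lia).
  move=> i w' lt; step ltac:(apply: run_emits); step ltac:(by apply: run_put => //=; lia).
  by rewrite -catA; apply: run_inc.
rewrite /not_gates -map_comp.
have := @run_reset N inp (w ++ flatten [seq [:: true, false, false & enc_nat p] | p <- iota 0 m])
    (state n m e j q 0 c2 c3) 8.
by apply; rewrite /=; lia.
Qed.

Lemma flatten_map_flatten (U V : Type) (f : U -> seq V) ss :
  flatten (map f (flatten ss)) = flatten [seq flatten (map f s) | s <- ss].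
Proof. by elim: ss => //= s ss IH; rewrite map_cat flatten_cat IH. Qed.

(** Register 5 is entry 3, the bit of [j] split off by [halve]. If it is 0, [nbits] is added to
    reach the negated input. *)
Definition eq_bit_p :=
  Seq (move 11 0)
 (Seq halve
 (Seq (move 0 11)
 (Seq (Case 5 (copy 7 0) Skip (dec 3))
 (Seq (copy 8 0)
 (Seq (emit true) (Seq enc (inc 8))))))).

Lemma run_eq_bit inp w n' p e j q c1 c2 c3 : p + m <= N -> q <= N ->
  run N eq_bit_p (conf inp w (state n' p e j q c1 c2 c3))
   (conf inp (w ++ true :: enc_nat (p + (if odd q then 0 else m))) (state n' p.+1 e j q./2 c1 c2
       c3)).
Proof.
move=> pN qN.
step ltac:(by apply: run_move => //=; lia).
step ltac:(by apply: run_halve => //=; lia).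
step ltac:(by apply: run_move => //=; lia).
apply: (@run_seq _ _ _ _ (conf inp w [:: if odd q then 0 else m; 0; 0; 0; k; n'; b; m; p; e; j;
    q./2; c1; c2; c3; 0; 0; 0])).
  apply: run_case => /=; case: odd => /=; first by apply: run_dec.
  by have := @run_copy N inp w (state n' p e j q./2 c1 c2 c3) 7 0; apply => //=; lia.
step ltac:(by apply: run_copy => //=; lia).
step ltac:(apply: run_emit).
step ltac:(by apply: run_enc => //=; case: (odd q) => /=; lia).
by rewrite -catA [X in enc_nat X]/= addnC; apply: run_inc.
Qed.

(** Entry 5 holds [n + 1] for a while, as [j] runs through 0, ..., [n]. The node counter starts at
    [b] to skip the block of the clock. *)
Definition eq_p :=
  Seq (inc 5)
 (Seq (for_ 5 12
   (Seq (copy 6 8)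
   (Seq (for_ 4 13
     (Seq (copy 10 11)
     (Seq (emits [:: true; false; true])
     (Seq (for_ 6 14 eq_bit_p)
     (Seq (emit false) (reset 11))))))
   (Seq (reset 8) (inc 10)))))
 (Seq (dec 5) (reset 10))).

Lemma iter_half l j : iter l half j = j %/ 2 ^ l.
Proof. by elim: l => [|l IH]; rewrite ?divn1 // iterS IH expnSr divnMA divn2. Qed.

Lemma run_eq inp w e :
  run N eq_p (conf inp w (state n 0 e 0 0 0 0 0))
   (conf inp (w ++ flatten [seq true :: enc_gate g | g <- eq_gates n k]) (state n 0 e 0 0 0 0 0)).
Proof.
have [kN nN bN mN zN] := bounds.
step ltac:(apply: run_inc).
step ltac:(apply: (@run_for N 5 12 _ _ _ (fun j => state n.+1 0 e j 0 0 0 0)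
   (fun j => flatten [seq true :: enc_gate (eq_gate n k j i.+1) | i <- iota 0 k]) n.+1) => //;
       first by lia).
  move=> j w1 lj; set c1 := n.+1 - j.+1.
  step ltac:(by apply: run_copy => //=; lia).
  step ltac:(apply: (@run_for N 4 13 _ _ _ (fun i => state n.+1 (i * b + b) e j 0 c1 0 0)
      (fun i => true :: enc_gate (eq_gate n k j i.+1)) k) => //; first by lia).
    move=> i w2 li; set c2 := k - i.+1.
    step ltac:(by apply: run_copy => //=; lia).
    step ltac:(apply: run_emits).
    step ltac:(apply: (@run_for N 6 14 _ _ _ (fun l => state n.+1 (l + (i * b + b)) e j (iter l
        half j) c1 c2 0)
      (fun l => true :: enc_nat (l + (i * b + b) + (if odd (iter l half j) then 0 else m))) b) =>
          //; first by lia).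
      move=> l w3 ll; apply: run_eq_bit.
        by rewrite /nbits in mN *; nia.
      by rewrite iter_half (leq_trans (leq_div _ _)) //; lia.
    step ltac:(apply: run_emit).
    apply: run_to (run_reset _ _ _) _.
      by rewrite /= iter_half (leq_trans (leq_div _ _)) //; lia.
    congr (conf _ _ _); last by rewrite /= (_ : i.+1 * b + b = b + (i * b + b)) // mulSn addnA.
    rewrite /eq_gate /enc_gate enc_seq_flatten -!catA; congr (_ ++ [:: _, _, _ & flatten _ ++ _]).
    by apply: eq_map => l; rewrite iter_half mulSnr [l + _]addnC.
  step ltac:(apply: run_reset => /=; rewrite /nbits in mN; nia).
  exact: run_inc.
step ltac:(apply: run_dec).
apply: run_to (run_reset _ _ _) _ => //; first by rewrite /=; lia.
congr (conf _ (_ ++ _) _); rewrite flatten_map_flatten -map_comp; congr flatten; apply: eq_map =>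
    j.
by rewrite /= (iotaDl 1) -!map_comp.
Qed.

(** Two copies of [nbits] lead to the first equality gate. These gates are ordered by [j] first, so
    each disjunction reads the next [k] of them, and the counter ends at [z], the value [circuit_p]
    starts from. *)
Definition or_p :=
  Seq (copy 7 8) (Seq (copy 7 8)
 (Seq (inc 5)
 (Seq (for_ 5 12 (Seq (emits [:: true; true; true]) (Seq (for_ 4 13 emit_p) (emit false))))
      (dec 5)))).

Lemma run_or inp w e :
  run N or_p (conf inp w (state n 0 e 0 0 0 0 0))
   (conf inp (w ++ flatten [seq true :: enc_gate g | g <- or_gates n k]) (state n z e 0 0 0 0 0)).
Proof.
have [kN nN bN mN zN] := bounds.
step ltac:(by apply: run_copy => //=; lia); step ltac:(by apply: run_copy => //=; lia).
step ltac:(apply: run_inc).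
step ltac:(apply: (@run_for N 5 12 _ _ _ (fun j => state n.+1 (j * k + (m + m)) e 0 0 0 0 0)
   (fun j => true :: enc_gate (Or [seq m.*2 + (j * k + i) | i <- iota 0 k])) n.+1) => //; first
       by lia).
  move=> j w1 lj; set c1 := n.+1 - j.+1.
  step ltac:(apply: run_emits).
  step ltac:(apply: (@run_for N 4 13 _ _ _ (fun i => state n.+1 (i + (j * k + (m + m))) e 0 0 c1
      0 0)
      (fun i => true :: enc_nat (i + (j * k + (m + m)))) k) => //; first by lia).
    move=> i w2 li; apply: run_emit_p.
    have : j * k <= n * k by rewrite leq_mul2r -ltnS lj orbT.
    by rewrite /zero_node in zN; lia.
  apply: run_to (run_emit _ _ _ _ _) _; rewrite mulSnr; congr (conf _ _ _); last first.
    by rewrite addnA [k + _]addnC.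
  rewrite /enc_gate enc_seq_flatten -!catA; congr (_ ++ [:: _, _, _ & flatten _ ++ _]).
  by apply: eq_map => i; rewrite addnn addnC addnAC [_ + m.*2]addnC addnA.
apply: run_to (run_dec _ _ _ _ _) _; congr (conf _ (_ ++ flatten _) _).
  by rewrite /or_gates -map_comp.
by rewrite /zero_node addnn addnC.
Qed.

Definition args_p g := Seq (parse g (Seq (emit true) add_nat)) (emit false).

Lemma run_args g inp w l (s : seq nat) :
  idle l -> nth 0 l 17 = 0 -> nth 0 l g = 0 -> nth 0 l 8 < N -> 8 < g < 17 ->
  size s < N -> all (fun i => bitlen i < N) s ->
  run N (args_p g) (conf (enc_seq enc_nat s ++ inp) w l)
    (conf inp (w ++ enc_seq enc_nat [seq i + nth 0 l 8 | i <- s]) l).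
Proof.
move=> il l17 lg pN g8 sN aN.
pose X (ys : seq nat) := w ++ flatten [seq true :: enc_nat (i + nth 0 l 8) | i <- ys].
apply: (@run_seq _ _ _ _ (conf inp (X s) l)); last first.
  by apply: run_emit_to; rewrite /X enc_seq_flatten catA.
have -> : w = X [::] by rewrite /X cats0.
apply: (@run_parse N _ _ g _ s inp X (fun=> l)) => // ys x zs inp' e.
step ltac:(apply: run_emit); set l' := set_nth _ _ _ _.
have l'E r : r != g -> nth 0 l' r = nth 0 l r by rewrite /l' nth_set_nth /= => /negPf->.
have xN : bitlen x < N by move: aN; rewrite e all_cat /= => /and3P[].
have il' : idle l' by rewrite /idle !l'E //; lia.
have := @run_add_nat N inp' (X ys ++ [:: true]) l' x il'.
rewrite !l'E ?l17; try by lia.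
move=> /(_ erefl pN xN); congr (run _ _ _ (conf _ _ _)).
by rewrite /X -cats1 map_cat flatten_cat /= cats0 -!catA.
Qed.

Definition gate_p :=
  Case 0 Skip
    (Seq (Pop 0) (Seq (emit false)
      (Case 0 Skip (Seq (Pop 0) (Seq (emit false) add_nat)) (Seq (Pop 0) (Seq (emit true) (args_p
          16))))))
    (Seq (Pop 0) (Seq (emit true) (Seq (Pop 0) (Seq (emit true) (args_p 16))))).

Definition small_gate g := (size (gate_args g) < N) && all (fun i => bitlen i < N) (gate_args g).

Lemma run_gate inp w l g :
  idle l -> nth 0 l 17 = 0 -> nth 0 l 16 = 0 -> nth 0 l 8 < N -> small_gate g ->
  run N gate_p (conf (enc_gate g ++ inp) w l)
    (conf inp (w ++ enc_gate (shift_gate (nth 0 l 8) g)) l).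
Proof.
move=> il l17 l16 pN /andP[sN aN]; apply: run_case; case: g sN aN => [i|s|s] sN aN /=.
- step ltac:(apply: run_read); step ltac:(apply: run_emit); apply: run_case => /=.
  step ltac:(apply: run_read); step ltac:(apply: run_emit).
  apply: run_to (run_add_nat _ _ il l17 pN _) _; first by move: aN; rewrite /= andbT.
  by rewrite -!catA.
- step ltac:(apply: run_read); step ltac:(apply: run_emit); apply: run_case => /=.
  step ltac:(apply: run_read); step ltac:(apply: run_emit).
  by apply: run_to (run_args _ _ il l17 l16 pN isT sN aN) _; rewrite -!catA.
- step ltac:(apply: run_read); step ltac:(apply: run_emit).
  step ltac:(apply: run_read); step ltac:(apply: run_emit).
  by apply: run_to (run_args _ _ il l17 l16 pN isT sN aN) _; rewrite -!catA.
Qed.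

(** Entry 9 counts nodes up to the number of the gate [Not z]. The second argument of the last
    conjunction is the shifted output of [C]: at this point the rest of the input is the list of
    outputs, which [args_p] turns into the tail of the argument list. *)
Definition circuit_p :=
  Seq (inc 8) (Seq (copy 8 9)
 (Seq (parse 15 (Seq (emit true) (Seq gate_p (inc 9))))
 (Seq (copy 5 9)
 (Seq (emits [:: true; false; false]) (Seq (copy 8 0) (Seq (dec 0) (Seq enc
 (Seq (emits [:: true; false; true; true]) (Seq (put 9) (Seq (args_p 15)
 (Seq (emits [:: false; true]) (Seq (inc 9) (Seq (put 9) (Seq (emit false)
 (Seq (reset 8) (reset 9)))))))))))))))).

Lemma run_circuit inp w gs o : size gs = G -> all small_gate gs -> bitlen o < N ->
  run N circuit_p (conf (enc_seq enc_gate gs ++ enc_seq enc_nat [:: o] ++ inp) w (state n z 0 0 0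
      0 0 0))
    (conf inp (w ++ enc_seq enc_gate (map (shift_gate z.+1) gs ++
                      [:: Not z; And [:: z.+1 + n + size gs; o + z.+1]]) ++
                    enc_seq enc_nat [:: final_out n k gs]) (state n 0 0 0 0 0 0 0)).
Proof.
have [kN nN bN mN zN] := bounds; move=> gsG small oN.
step ltac:(apply: run_inc); step ltac:(by apply: run_copy => //=; lia).
pose X (ys : seq gate) := w ++ flatten [seq true :: enc_gate (shift_gate z.+1 g) | g <- ys].
have {1}-> : w = X [::] by rewrite /X cats0.
step ltac:(apply: (@run_parse N _ _ 15 _ gs _ X (fun ys => state n z.+1 (size ys + z.+1) 0 0 0 0
    0)) => //; first by lia).
  move=> ys x zs inp' e.
  have sx : small_gate x by move: small; rewrite e all_cat /= => /and3P[].
  step ltac:(apply: run_emit); step ltac:(by apply: run_gate => //=; lia).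
  apply: run_to (run_inc _ _ _ _ _) _; rewrite size_rcons; congr (conf _ _ _).
  by rewrite /X -cats1 map_cat flatten_cat /= cats0 -!catA.
step ltac:(by apply: run_copy => //=; lia); step ltac:(apply: run_emits).
step ltac:(by apply: run_copy => //=; lia); step ltac:(apply: run_dec).
step ltac:(by apply: run_enc => //=; lia).
step ltac:(apply: run_emits); step ltac:(by apply: run_put => //=; lia).
step ltac:(by apply: run_args => //=; rewrite ?oN //; lia).
step ltac:(apply: run_emits); step ltac:(apply: run_inc).
step ltac:(by apply: run_put => //=; lia); step ltac:(apply: run_emit).
step ltac:(by apply: run_reset => //=; lia).
apply: run_to (run_reset _ _ _) _; first by rewrite /=; lia.
congr (conf _ _ _); rewrite /X !enc_seq1 /final_out.
rewrite /enc_seq !map_cat !flatten_cat -map_comp.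
rewrite ![nth _ _ _]/= addn1; have -> : z.+1 + n + size gs = size gs + z.+1 + n by lia.
set u := size gs + z.+1 + n; set v := o + z.+1.
have -> : flatten [seq true :: enc_gate a | a <- [:: Not z; And [:: u; v]]] =
    [:: true; false; false] ++ enc_nat z ++ [:: true; false; true; true] ++ enc_nat u ++
    true :: enc_nat v ++ [:: false].
  by rewrite /= /enc_seq /=; move: enc_nat => f; rewrite !cats0 -!catA.
by move: enc_nat => f; rewrite -!catA.
Qed.

Definition final_p := Seq not_p (Seq eq_p (Seq or_p circuit_p)).

Lemma run_final inp w gs o : size gs = G -> all small_gate gs -> bitlen o < N ->
  run N final_p (conf (enc_seq enc_gate gs ++ enc_seq enc_nat [:: o] ++ inp) w (state n 0 0 0 0 0
      0 0))
    (conf inp (w ++ enc_seq enc_gate (final_gates n k gs o) ++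
                    enc_seq enc_nat [:: final_out n k gs]) (state n 0 0 0 0 0 0 0)).
Proof.
move=> gsG small oN.
step ltac:(apply: run_not); step ltac:(apply: run_eq); step ltac:(apply: run_or).
apply: run_to (run_circuit _ _ gsG small oN) _; congr (conf _ _ _).
rewrite /final_gates; move: (not_gates n k) (eq_gates n k) (or_gates n k) => A B D.
by rewrite /enc_seq !map_cat !flatten_cat -!catA.
Qed.

(** [C] occurs only once in the automaton, in the final guard, so the input is consumed in one pass
    and never stored. *)
Definition main_p :=
  Seq (parse 15 (inc 4)) (Seq (parse 15 (inc 5))
 (Seq (copy 5 0) (Seq (bits (Seq (Case 5 Skip Skip (dec 3)) (inc 6)))
 (Seq (copy 6 7) (Seq (inc 7) (Seq (for_ 4 12 (copy 6 7))
 (Seq header_p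
 (Seq (emits (true :: enc_nat 0)) (Seq ready_p (Seq record_p
 (Seq (emits (enc_nat 0 ++ true :: enc_nat 0))
 (Seq unary_m (Seq final_p (Seq record_p
 (Seq (emits (enc_nat 1 ++ [:: false]))
 (Seq (for_ 5 12 (emits (true :: enc_nat 0))) (emit false))))))))))))))))).

Definition main_code gs o : seq bool :=
  header_code ++
  (true :: enc_nat 0) ++
  (enc_unary m ++ enc_seq enc_gate [::] ++ enc_seq enc_nat [:: k.+1 * b]) ++
  (enc_unary m ++ enc_seq enc_gate [:: Or [::]] ++ enc_seq enc_nat (record_outs n k)) ++
  (enc_nat 0 ++ true :: enc_nat 0) ++
  enc_unary m ++
  (enc_seq enc_gate (final_gates n k gs o) ++ enc_seq enc_nat [:: final_out n k gs]) ++
  (enc_unary m ++ enc_seq enc_gate [:: Or [::]] ++ enc_seq enc_nat (record_outs n k)) ++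
  (enc_nat 1 ++ [:: false]) ++
  flatten [seq true :: enc_nat 0 | _ <- iota 0 n] ++ [:: false].

Lemma enc_unary_seq x : enc_unary x = enc_seq (fun _ => [::]) (nseq x tt).
Proof. by rewrite /enc_unary -cats1 /enc_seq; congr (_ ++ _); elim: x => //= x ->. Qed.

Lemma run_main gs o : size gs = G -> all small_gate gs -> bitlen o < N ->
  run N main_p
    (init (enc_unary k ++ enc_unary n ++ enc_seq enc_gate gs ++ enc_seq enc_nat [:: o]))
    (conf [::] (main_code gs o) (state n 0 0 0 0 0 0 0)).
Proof.
have [kN nN bN mN zN] := bounds; move=> gsG small oN.
have -> (x : seq bool) : init x = conf x [::] (nseq 18 0).
  by apply: functional_extensionality => -[|[|r]] //; rewrite /conf nth_nseq if_same.
rewrite !enc_unary_seq.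
step ltac:(apply: (@run_parse N _ _ 15 _ (nseq k tt) _ (fun=> [::])
  (fun ys => [:: 0; 0; 0; 0; size ys; 0; 0; 0; 0; 0; 0; 0; 0; 0; 0; 0; 0; 0])) => //; first by
      rewrite size_nseq).
  by move=> ys x zs inp' _; rewrite size_rcons; apply: run_inc.
rewrite size_nseq.
step ltac:(apply: (@run_parse N _ _ 15 _ (nseq n tt) _ (fun=> [::])
  (fun ys => [:: 0; 0; 0; 0; k; size ys; 0; 0; 0; 0; 0; 0; 0; 0; 0; 0; 0; 0])) => //; first by
      rewrite size_nseq; lia).
  by move=> ys x zs inp' _; rewrite size_rcons; apply: run_inc.
rewrite size_nseq.
step ltac:(by apply: run_copy => //=; lia).
(* The bits of [n] are discarded; entry 6 counts them and ends as [bitlen n]. *)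
apply: (@run_seq _ _ _ _ (conf (enc_seq enc_gate gs ++ enc_seq enc_nat [:: o]) [::] [:: 0; 0; 0;
    0; k; n; b; 0; 0; 0; 0; 0; 0; 0; 0; 0; 0; 0])).
  have := @run_bits N (Seq (Case 5 Skip Skip (dec 3)) (inc 6)) (enc_seq enc_gate gs ++ enc_seq
      enc_nat [:: o])
    (fun=> [::]) (fun i => [:: n %/ 2 ^ i; 0; 0; 0; k; n; i; 0; 0; 0; 0; 0; 0; 0; 0; 0; 0; 0]) n.
  rewrite [n %/ 2 ^ 0]divn1 [n %/ 2 ^ bitlen n]divn_small ?ltn_exp_bitlen //.
  apply=> [|//|i lt]; first by lia.
  pose l := [:: n %/ 2 ^ i.+1; 0; 0; 0; k; n; i; 0; 0; 0; 0; 0; 0; 0; 0; 0; 0; 0].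
  apply: (@run_seq _ _ _ _ (conf (enc_seq enc_gate gs ++ enc_seq enc_nat [:: o]) [::] l)); last
      first.
    exact: run_inc.
  apply: run_case => /=; case: (odd _) => /=; last exact: run_skip.
  exact: run_dec.
step ltac:(by apply: run_copy => //=; lia); step ltac:(apply: run_inc).
step ltac:(apply: (@run_for N 4 12 _ _ _ (fun i => [:: 0; 0; 0; 0; k; n; b; (i * b + b).+1; 0; 0;
    0; 0; 0; 0; 0; 0; 0; 0]) (fun=> [::]) k) => //; first by lia).
  move=> i w' lt; apply: run_to (run_copy _ _ _ _ _ _ _) _; rewrite //=; first by lia.
  by rewrite cats0 mulSn; congr (conf _ _ [:: _, _, _, _, _, _, _, _ & _]); lia.
have -> : flatten [seq [::] | _ <- iota 0 k] = [::] :> seq bool by elim: iota.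
rewrite [[::] ++ [::]]/=; have -> : (k * b + b).+1 = m by rewrite /nbits mulSn addn1 addnC.
step ltac:(apply: run_header).
step ltac:(apply: run_emits).
step ltac:(apply: run_ready).
step ltac:(apply: run_record).
step ltac:(apply: run_emits).
step ltac:(apply: run_unary_m).
apply: run_seq.
  have := run_final [::] _ gsG small oN; rewrite cats0; exact.
step ltac:(apply: run_record).
step ltac:(apply: run_emits).
step ltac:(apply: (@run_for N 5 12 _ _ _ (fun=> state n 0 0 0 0 0 0 0) (fun=> true :: enc_nat 0)
    n) => //; first by lia).
  by move=> i w' _; apply: run_emits.
by apply: run_emit_to; rewrite /main_code -!catA.
Qed.
End Main.

(** * The output is the code of the automaton and the word *)

Lemma map_const_iota (U : Type) (c : U) a n : [seq c | _ <- iota a n] = nseq n c.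
Proof. by elim: n a => //= n IH a; rewrite IH. Qed.

Section Code.
Variables (n k : nat) (C : circuit n 1).

Lemma enc_ready_guard : enc_circuit (ready_guard n k) =
  enc_unary (nbits n k) ++ enc_seq enc_gate [::] ++ enc_seq enc_nat [:: k.+1 * bitlen n].
Proof. by rewrite -sw_assignment_bits. Qed.

Lemma enc_record_action : enc_circuit (record_action n k) =
  enc_unary (nbits n k) ++ enc_seq enc_gate [:: Or [::]] ++ enc_seq enc_nat (record_outs n k).
Proof. by rewrite -[in RHS]sw_assignment_bits. Qed.

Lemma enc_final_guard : enc_circuit (final_guard k C) =
  enc_unary (nbits n k) ++ enc_seq enc_gate (final_gates n k (gates C) (thead (outs C))) ++
  enc_seq enc_nat [:: final_out n k (gates C)].
Proof. by rewrite -[in RHS]sw_assignment_bits. Qed.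

Lemma sw_automaton_code :
  enc_automaton (sw_automaton k C) =
  header_code n k ++ enc_seq (@enc_transition _ _) (transitions (sw_automaton k C)).
Proof.
have E : enum 'I_2 = [:: ord0; ord_max].
  by apply: (inj_map val_inj); rewrite val_enum_ord.
rewrite /enc_automaton /header_code.
have -> : flatten [seq enc_nat (label q) | q <- enum 'I_(nstates (sw_automaton k C))] =
    enc_nat 0 ++ enc_nat 0 by rewrite E.
have -> : flatten [seq enc_nat (bound x) | x <- enum 'I_(nwatches (sw_automaton k C))] =
    flatten [seq enc_nat n | _ <- iota 0 k] ++ enc_nat n ++ enc_nat 1.
  rewrite (map_enum_ord_rcons _ (fun x => enc_nat (if x == k.+1 then 1 else n))).
  rewrite eqxx flatten_rcons catA; congr (_ ++ _).
  have -> : [seq enc_nat (if i == k.+1 then 1 else n) | i <- iota 0 k.+1] = [seq enc_nat n | _ <-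
      iota 0 k.+1].
    by apply/eq_in_map => i; rewrite mem_iota => lt; rewrite ltn_eqF.
  by rewrite -addn1 iotaD map_cat flatten_cat /= cats0.
have -> : [seq active x q | x <- enum 'I_(nwatches (sw_automaton k C)), q <- enum 'I_(nstates
    (sw_automaton k C))] =
    [:: true; true] ++ flatten [seq [:: false; false] | _ <- iota 0 k] ++ [:: true; true].
  rewrite E.
  rewrite (map_enum_ord_rcons _ (fun x => [seq ((x == 0) || (x == k.+1)) | q <- [:: ord0 : 'I_2;
      ord_max]])).
  rewrite eqxx flatten_rcons orbT /= (iotaDl 1) -map_comp; congr [:: _, _ & flatten _ ++ _].
  by apply/eq_in_map => i; rewrite mem_iota /= add1n => lt; rewrite eqSS ltn_eqF.
have -> : enc_unary k.+2 = [:: true; true] ++ flatten [seq [:: true] | _ <- iota 0 k] ++ [::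
    false].
  rewrite /enc_unary -cats1 /=; congr (_ :: _ :: (_ ++ _)).
  by rewrite -{1}(size_iota 0 k); elim: iota => //= ? l ->.
rewrite -[nat_of_ord (start _)]/0 -[nat_of_ord (accept _)]/1.
rewrite -[nstates _]/2 -[nletters _]/1.
(* Only associativity is left; abstracting the encoders keeps [/=] from unfolding them. *)
move: (enc_unary 2) (enc_unary 1) (enc_seq _ _) enc_nat (flatten _) => a b c f d.
by rewrite -!catA /= -!catA.
Qed.

Lemma main_code_enc :
  main_code n k (gates C) (thead (outs C)) =
  enc_automaton_word (nseq n ord0 : seq 'I_(nletters (sw_automaton k C))).
Proof.
have T : enc_seq (@enc_transition _ _) (transitions (sw_automaton k C)) =
    (true :: enc_nat 0 ++ enc_circuit (ready_guard n k) ++ enc_circuit (record_action n k) ++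
        enc_nat 0) ++
    (true :: enc_nat 0 ++ enc_circuit (final_guard k C) ++ enc_circuit (record_action n k) ++
        enc_nat 1) ++
    [:: false].
  by rewrite /enc_seq /= cats0 -!catA.
have L : enc_seq (fun a : 'I_(nletters (sw_automaton k C)) => enc_nat a) (nseq n ord0) =
    flatten [seq true :: enc_nat 0 | _ <- iota 0 n] ++ [:: false].
  by rewrite /enc_seq map_nseq map_const_iota.
rewrite /enc_automaton_word sw_automaton_code {}L {}T enc_ready_guard enc_record_action
    enc_final_guard.
rewrite /main_code; move: enc_seq enc_nat header_code enc_unary flatten => f g h u d.
by rewrite -!catA /= -!catA.
Qed.
End Code.

(** * Running times *)

(** The output was pushed on a stack; moving it to register 0 also restores its order. *)
Definition flip_p :=
  While 1 (Case 1 Skip (Seq (Pop 1) (Push 0 false)) (Seq (Pop 1) (Push 0 true))).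

Lemma run_flip w l : exists2 s, run (size w) flip_p (conf [::] w l) s & s 0 = w.
Proof.
pose S i := fun r => if r is r'.+1 then if r' is r''.+1 then nseq (nth 0 l r'') true
  else drop i (rev w) else rev (take i (rev w)).
exists (S (size w)); last by rewrite /S /= -(size_rev w) take_size revK.
have -> : conf [::] w l = S 0.
  by apply: functional_extensionality => -[|[|r]] //=; rewrite ?take0 ?drop0.
apply: run_while => [//|i lt|]; last by rewrite /= -(size_rev w) drop_size.
have lt' : i < size (rev w) by rewrite size_rev.
rewrite /= (drop_nth false lt'); split=> //; apply: run_case; rewrite /= (drop_nth false lt').
set x := nth false (rev w) i.
suff H : run (size w) (Seq (Pop 1) (Push 0 x)) (S i) (S i.+1) by case: x H.
apply: run_seq (run_pop _ _ _) _; set s := upd _ _ _.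
have -> : S i.+1 = upd s 0 (x :: s 0); last exact: run_push.
apply: functional_extensionality => -[|[|r]] //=.
  by rewrite /upd /= (take_nth false lt') rev_rcons.
by rewrite /s /upd /= (drop_nth false lt').
Qed.

(** * Polynomially bounded functions *)

Definition poly (F : nat -> nat) := exists c, forall x, 0 < x -> F x <= c * x ^ c.

Lemma poly_le (F : nat -> nat) c d : (forall x, 0 < x -> F x <= c * x ^ d) -> poly F.
Proof.
move=> H; exists (c + d) => x x0; apply: leq_trans (H x x0) _.
by rewrite leq_mul ?leq_addr // leq_pexp2l // leq_addl.
Qed.

Lemma poly_const c : poly (fun=> c).
Proof. by apply: (@poly_le _ c 0) => x _; rewrite muln1. Qed.

Lemma poly_id : poly id.
Proof. by apply: (@poly_le _ 1 1) => x _; rewrite mul1n. Qed.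

Lemma poly_add F G : poly F -> poly G -> poly (fun x => F x + G x).
Proof.
move=> [c H] [d H']; apply: (@poly_le _ (c + d) (c + d)) => x x0.
rewrite mulnDl leq_add //; [apply: leq_trans (H x x0) _|apply: leq_trans (H' x x0) _];
by rewrite leq_mul2l leq_pexp2l ?leq_addr ?leq_addl ?orbT.
Qed.

Lemma poly_mul F G : poly F -> poly G -> poly (fun x => F x * G x).
Proof.
move=> [c H] [d H']; apply: (@poly_le _ (c * d) (c + d)) => x x0.
by rewrite expnD mulnACA leq_mul ?H ?H'.
Qed.

Lemma poly_comp F G : (forall x, 0 < x -> 0 < G x) -> poly F -> poly G -> poly (fun x => F (G x)).
Proof.
move=> G0 [c H] [d H']; apply: (@poly_le _ (c * d ^ c) (d * c)) => x x0.
apply: leq_trans (H _ (G0 x x0)) _; rewrite -mulnA leq_mul2l expnM -expnMn.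
by case: c {H} => // c; rewrite leq_exp2r ?H' ?orbT.
Qed.

Lemma poly_exp F c : poly F -> poly (fun x => F x ^ c).
Proof.
move=> pF; elim: c => [|c IH]; first exact: poly_const.
by have [d H] := poly_mul pF IH; exists d => x x0; rewrite expnS H.
Qed.

Lemma tm_gt0 p N : 0 < tm p N.
Proof. by elim: p => //= *; lia. Qed.

Lemma size_enc_seq_gt (U : Type) (e : U -> seq bool) s : size s < size (enc_seq e s).
Proof. by rewrite /enc_seq size_cat addn1 ltnS; elim: s => //= a s IH; rewrite size_cat; lia. Qed.

Lemma size_enc_seq_item (U : Type) (e : U -> seq bool) s :
  all (fun a => size (e a) < size (enc_seq e s)) s.
Proof.
rewrite /enc_seq size_cat addn1; elim: s => //= a s IH; rewrite size_cat; apply/andP; split;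
    first by lia.
by apply: sub_all IH => b; lia.
Qed.

Lemma bitlen_lt a : bitlen a < size (enc_nat a).
Proof. by have := size_enc_seq_gt (fun b => [:: b]) (to_bits (bitlen a) a); rewrite size_to_bits.
    Qed.

Lemma all_bitlen N s : size (enc_seq enc_nat s) <= N -> all (fun i => bitlen i < N) s.
Proof.
move=> le; apply: sub_all (size_enc_seq_item enc_nat s) => i lt.
by have := bitlen_lt i; lia.
Qed.

Lemma all_small_gate N gs : size (enc_seq enc_gate gs) <= N -> all (small_gate N) gs.
Proof.
move=> le; apply: sub_all (size_enc_seq_item enc_gate gs) => g lt; rewrite /small_gate.
case: g lt => [i|s|s] /= lt; first by have := bitlen_lt i; rewrite andbT; lia.
  have := size_enc_seq_gt enc_nat s => lt'; rewrite all_bitlen; lia.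
have := size_enc_seq_gt enc_nat s => lt'; rewrite all_bitlen; lia.
Qed.

Definition reduction_p := Seq main_p flip_p.

Lemma reduction_time :
  exists2 R, poly R & forall n k (C : circuit n 1),
    let x := enc_unary k ++ enc_circuit C in
    runs reduction_p x (R (size x)) (enc_automaton_word (nseq n ord0 : seq 'I_(nletters
        (sw_automaton k C)))).
Proof.
(* Node numbers reach about [2 * k.+1 * bitlen n + n.+1 * k], which is quadratic in the input
   length; the factor 20 is generous enough for the lower-order terms of the hypothesis [big]. *)
pose T x := tm main_p (20 * x ^ 2).
exists (fun x => T x + tm flip_p (T x)).
  have pT : poly T.
    apply: (@poly_comp (tm main_p) (fun x => 20 * x ^ 2)) => [x x0||]; first by rewrite muln_gt0
        expn_gt0 x0.
      exact: tm_poly.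
    by apply: poly_mul; [exact: poly_const | apply: poly_exp; exact: poly_id].
  apply: poly_add => //; apply: (@poly_comp (tm flip_p) T) _ (tm_poly _) pT => x _.
  exact: tm_gt0.
move=> n k C x; set Z := size x; set N := 20 * Z ^ 2.
have xE : x = enc_unary k ++ enc_unary n ++ enc_seq enc_gate (gates C) ++ enc_seq enc_nat [::
    thead (outs C)].
  rewrite /x /enc_circuit; congr (_ ++ (_ ++ (_ ++ _))).
  by case/tupleP: (outs C) => o t; rewrite theadE /= (tuple0 t).
have ZE : Z = k.+1 + (n.+1 + (size (enc_seq enc_gate (gates C)) + size (enc_seq enc_nat [:: thead
    (outs C)]))).
  by rewrite /Z xE !size_cat !size_rcons !size_nseq.
have sg := size_enc_seq_gt enc_gate (gates C).
have so := size_enc_seq_gt enc_nat [:: thead (outs C)].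
have ZN : Z <= N by rewrite /N !expnS expn0 muln1; nia.
have big : zero_node n k + n + size (gates C) + 10 < N.
  have mb : nbits n k <= Z * Z + 1.
    by have := bitlen_le n; rewrite /nbits leq_add2r => bn; apply: leq_mul => //; lia.
  have : n.+1 * k <= Z * Z by apply: leq_mul => //; lia.
  rewrite /zero_node -addnn /N !expnS expn0 muln1; nia.
have sN : size (enc_seq enc_gate (gates C)) <= N by lia.
have oN : size (enc_seq enc_nat [:: thead (outs C)]) <= N by lia.
have /andP[bo _] := all_bitlen oN.
have [t e le] := run_main big (erefl _) (all_small_gate sN) bo.
set w := main_code _ _ _ _ in e.
have [s [t' e' le'] sw] := run_flip w [:: 0; 0; 0; 0; k; n; bitlen n; nbits n k; 0; 0; 0; 0; 0;
    0; 0; 0; 0; 0].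
exists (t + t'), s; split; last by rewrite sw -main_code_enc.
  by rewrite xE; apply: exec_seq e e'.
rewrite leq_add //; apply: leq_trans le' _.
have : size w <= T Z.
  have := exec_size 1 e; rewrite [size (conf _ _ _ _)]size_rev -[init _ 1]/[::] add0n => H.
  exact: leq_trans H le.
by rewrite /=; move: (size w) => v; rewrite ltnS => vT; rewrite leq_mul2r vT.
Qed.

(** * From acceptance to fixed-parameter tractability *)

Lemma computable_addn f c : computable f -> computable (fun n => f n + c).
Proof.
move=> cf; elim: c => [|c IH]; first by apply: computable_ext cf => n; rewrite addn0.
by apply: computable_ext (computable_comp IH computable_succ) => n; rewrite /= addnS.
Qed.

Lemma runs_size p x T y : runs p x T y -> size y <= size x + T.
Proof.
move=> [t [s [e le <-]]]; apply: leq_trans (exec_size 0 e) _.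
by rewrite /init /upd /= leq_add2l.
Qed.

Lemma max_sw_bound n k (C : circuit n 1) : maxn 1 (max_bound (sw_automaton k C)) <= n.+1.
Proof.
rewrite geq_max; apply/andP; split=> //; apply/bigmax_leqP => x _.
by rewrite /= /sw_bound; case: ifP.
Qed.

Section Assembly.
Variables (f : nat -> nat) (p : prog) (e : nat).
Hypothesis dec : decides_acceptance_in_time p (time_bound f e).

Lemma wsat_time : exists2 R, poly R & forall n k (C : circuit n 1),
  let x := enc_unary k ++ enc_circuit C in
  exists b : bool,
    runs (comp reduction_p p) x (R (size x * (f k.+2).+1)) [:: b] /\
    (b <-> exists2 a : n.-tuple bool, count id a = k & eval C a = [:: true]).
Proof.
have [R [c H] HR] := reduction_time.
(* [R] need not be monotone, but its bound [M] is, and is compared at two arguments below. *)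
pose M y := c * y ^ c.
have pM : poly M by exists c.
exists (fun y => M y + e * ((y + M y) * y * y * y) ^ e).
  apply: poly_add => //; apply: poly_mul; first exact: poly_const.
  apply: poly_exp; do 3! (apply: poly_mul; last exact: poly_id).
  by apply: poly_add => //; exact: poly_id.
move=> n k C x; set y := size x * _.
have [b [rb ib]] := dec (nseq n ord0 : seq 'I_(nletters (sw_automaton k C))).
exists b; split; last by rewrite ib; exact: sw_automaton_correct.
have r1 := HR n k C; rewrite -/x in r1.
have xn : n.+1 + k.+1 <= size x.
  by rewrite /x !size_cat !size_rcons !size_nseq; lia.
have xy : size x <= y by rewrite leq_pmulr.
have x0 : 0 < size x by lia.
have T1 : R (size x) <= M y.
  apply: leq_trans (H _ x0) _; rewrite leq_mul2l; apply/orP; right.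
  by case: (c) => // c'; rewrite leq_exp2r.
apply: runs_le (runs_comp r1 rb) _; apply: leq_add => //.
rewrite /time_bound leq_mul2l; apply/orP; right.
(* The code of the automaton is no longer than the input plus the time of the reduction; each of the
   other three factors is at most [y]. *)
have le : size (enc_automaton (sw_automaton k C)) * maxn 1 (f k.+2) *
    maxn 1 (max_bound (sw_automaton k C)) * maxn 1 (size (nseq n (ord0 : 'I_1))) <=
    (y + M y) * y * y * y.
  have := runs_size r1; rewrite size_cat => sz.
  apply: leq_mul; last by rewrite size_nseq; lia.
  apply: leq_mul; last by apply: leq_trans (max_sw_bound _ _) _; lia.
  apply: leq_mul; first by lia.
  by apply: leq_trans (leq_pmull _ x0); rewrite geq_max leqnSn.
by case: (e) => // e'; rewrite leq_exp2r.
Qed.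
End Assembly.

Theorem mainTheorem15 (f : nat -> nat) :
  FPT_does_not_contain_W_hierarchy ->
  computable f ->
  ~ (exists (p : prog) (e : nat),
       decides_acceptance_in_time p (time_bound f e)).
Proof.
move=> [i [L [_ [d [p1 [g [h [c [cg ch red]]]]]]]]] notFPT cf [p [e dec]]; apply: notFPT.
have [R [a HR] H] := wsat_time dec.
(* The sum dominates [f (k'.+2)] for every weight [k'] up to [h x], although [f] need not be
   monotone. *)
pose Phi x := \sum_(i < (h x).+2) f i.+1.
have cPhi : computable Phi.
  exact: computable_comp (computable_comp ch (computable_comp computable_succ computable_succ))
      (computable_sum cf).
pose X x := (g x).+1 + (Phi x).+1 + a.
have cX : computable X.
  apply: computable_addn; apply: computable_add.
    exact: computable_comp cg computable_succ.
  exact: computable_comp cPhi computable_succ.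
(* Two powers [a] come from the two factors [X] that bound the argument of [R], one [X] bounds the
   factor [a], and one absorbs the sum of the two running times. In the exponent of the input size,
   [c] pays for the given reduction and [c.+1 * a] for the decision on its output. *)
have [G cG HG] := computable_exp_bound (a + a + 2) cX.
exists (comp p1 (comp reduction_p p)), G, (c + c.+1 * a); split=> // I.
have [J [rJ Jk IJ]] := red I; set x := input I in rJ *; set K := param I in rJ Jk *.
have [b [rb ib]] := H (wsat_inputs J) (wsat_weight J) (wsat_circuit J).
exists b; split; last by rewrite ib IJ.
apply: runs_le (runs_comp rJ rb) _.
set y := enc_unary _ ++ _.
have x0 : 0 < size x by rewrite size_cat size_rcons.
have y0 : 0 < size y by rewrite size_cat size_rcons.
(* The output is at most input plus time long; the exponent [c.+1] covers the input itself even if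
   [c] is 0. *)
have ys : size y <= (g K).+1 * size x ^ c.+1.
  apply: leq_trans (runs_size rJ) _; rewrite mulSn leq_add //.
    by rewrite -{1}[size x]expn1 leq_pexp2l.
  by rewrite leq_mul2l leq_pexp2l ?orbT.
have fP : f (wsat_weight J).+2 <= Phi K.
  have lt : (wsat_weight J).+1 < (h K).+2 by [].
  by rewrite /Phi (bigD1 (Ordinal lt)) //= leq_addr.
have yX : size y * (f (wsat_weight J).+2).+1 <= X K * X K * size x ^ c.+1.
  rewrite mulnAC; apply: leq_mul; last first.
    by rewrite /X; lia.
  by apply: leq_trans ys _; rewrite leq_mul // /X; lia.
have y1 : 0 < size y * (f (wsat_weight J).+2).+1 by rewrite muln_gt0 y0.
apply: (@leq_trans (X K * size x ^ (c + c.+1 * a) + X K * (X K * X K) ^ a * size x ^ (c + c.+1 *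
    a))).
  apply: leq_add.
    apply: leq_mul; first by rewrite /X; lia.
    by rewrite leq_pexp2l // leq_addr.
  apply: leq_trans (HR _ y1) _; rewrite -mulnA; apply: leq_mul; first by rewrite /X; lia.
  apply: (@leq_trans ((X K * X K * size x ^ c.+1) ^ a)).
    by case: (a) => // a'; rewrite leq_exp2r.
  by rewrite expnMn -expnM leq_mul // leq_pexp2l // leq_addl.
rewrite -mulnDl leq_mul2r; apply/orP; right; apply: leq_trans (HG K).
have X2 : 1 < X K by rewrite /X; lia.
have -> : X K ^ (a + a + 2) = X K * (X K * (X K * X K) ^ a).
  by rewrite expnMn -expnD addn2 !expnS.
have : 0 < (X K * X K) ^ a by rewrite expn_gt0 muln_gt0 (ltnW X2).
by set u := _ ^ a; move: (X K) u X2 => v u v2 u0; nia.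
Qed.
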